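(* Let $f\colon S^2\to S^2$ be a Thurston map such that for some iterate $F=f^n$ ($n\ge1$) there exists a continuous surjective map $\gamma\colon S^1\to S^2$ satisfying $F(\gamma(z))=\gamma(z^d)$ for all $z\in S^1$, where $d=\deg F$. Then $f$ is expanding.
   Context: A Thurston map is an orientation-preserving branched covering $f\colon S^2\to S^2$ (locally of the form $z\mapsto z^q$ after orientation-preserving homeomorphic changes of coordinates) that is postcritically finite, i.e. $\operatorname{post}(f)=\bigcup_{n\ge1}\{f^n(c): c \text{ critical}\}$ is finite; it is assumed that $\#\operatorname{post}(f)\ge3$. Fix a metric on $S^2$ inducing its topology. $f$ is expanding if for some (equivalently every) Jordan curve $\mathcal{C}\supset\operatorname{post}(f)$, the maximal diameter of a component of $S^2\setminus f^{-n}(\mathcal{C})$ tends to $0$ as $n\to\infty$. *)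

(* Defs.v *)
From HB Require Import structures.
From mathcomp Require Import all_boot all_order all_algebra.
From mathcomp Require Import all_classical all_reals all_analysis.
Set Implicit Arguments. Unset Strict Implicit. Unset Printing Implicit Defensive.
Import Order.TTheory GRing.Theory Num.Theory.
Import numFieldNormedType.Exports.
Local Open Scope classical_set_scope.
Local Open Scope ring_scope.
Local Open Scope card_scope.

Section Defs.
Variable R : realType.
Local Notation P2 := 'rV[R]_2.
Local Notation P3 := 'rV[R]_3.

Definition c2 (x : P2) (i : nat) : R := x ord0 (inord i).
Definition c3 (x : P3) (i : nat) : R := x ord0 (inord i).
Definition mk2 (a b : R) : P2 := \row_(i < 2) (if val i == 0%N then a else b).
Definition mk3 (a b c : R) : P3 :=
  \row_(i < 3) (if val i == 0%N then a else if val i == 1%N then b else c).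

Definition sq2 (x : P2) : R := c2 x 0 ^+ 2 + c2 x 1 ^+ 2.

Definition S1 : set P2 := [set z | sq2 z = 1].
Definition Disk : set P2 := [set z | sq2 z < 1].
Definition S2 : set P3 := [set x | c3 x 0 ^+ 2 + c3 x 1 ^+ 2 + c3 x 2 ^+ 2 = 1].

Definition cmul (z w : P2) : P2 :=
  mk2 (c2 z 0 * c2 w 0 - c2 z 1 * c2 w 1) (c2 z 0 * c2 w 1 + c2 z 1 * c2 w 0).
Definition cpow (z : P2) (n : nat) : P2 := iter n (cmul z) (mk2 1 0).

(* winding number of a loop l : [0,1] -> R^2 \ {0} around 0 equals k:
   a continuous lift of the argument increases by 2 pi k *)
Definition winding_is (l : R -> P2) (k : int) : Prop :=
  exists th : R -> R,
    {within [set t : R | 0 <= t <= 1], continuous th} /\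
    (forall t, 0 <= t <= 1 ->
       l t = Num.sqrt (sq2 (l t)) *: mk2 (cos (th t)) (sin (th t))) /\
    th 1 - th 0 = 2 * pi * k%:~R.

Definition circ (p : P2) (r : R) (t : R) : P2 :=
  p + r *: mk2 (cos (2 * pi * t)) (sin (2 * pi * t)).
Definition cdisk (p : P2) (r : R) : set P2 := [set z | sq2 (z - p) <= r ^+ 2].

(* an injective continuous map h on an open planar set O is orientation
   preserving: every small positively oriented circle around p is mapped to
   a loop winding once (positively) around h p *)
Definition orient_pres (O : set P2) (h : P2 -> P2) : Prop :=
  forall p r, O p -> 0 < r -> cdisk p r `<=` O ->
    winding_is (fun t => h (circ p r t) - h p) 1.

(* inverse stereographic projection R^2 -> S^2 \ {N}; fixes the orientation of S^2 *)
Definition sigma_inv (u : P2) : P3 :=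
  (1 + sq2 u)^-1 *: mk3 (2 * c2 u 0) (2 * c2 u 1) (sq2 u - 1).

Definition rel_open (U : set P3) : Prop :=
  U `<=` S2 /\ exists O : set P3, open O /\ U = O `&` S2.

Definition homeo_onto (U : set P3) (D : set P2) (phi : P3 -> P2) (phii : P2 -> P3) :=
  [/\ (forall x, U x -> D (phi x)), (forall z, D z -> U (phii z)),
      (forall x, U x -> phii (phi x) = x), (forall z, D z -> phi (phii z) = z) &
      {within U, continuous phi} /\ {within D, continuous phii}].

Definition chart (U : set P3) (phi : P3 -> P2) (phii : P2 -> P3) : Prop :=
  [/\ rel_open U, homeo_onto U Disk phi phii &
      orient_pres [set u | U (sigma_inv u)] (phi \o sigma_inv)].

Definition local_form (f : P3 -> P3) (p : P3) (q : nat) : Prop :=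
  exists U V (phi : P3 -> P2) (phii : P2 -> P3) (psi : P3 -> P2) (psii : P2 -> P3),
    [/\ U p /\ V (f p), chart U phi phii, chart V psi psii,
        phi p = 0 /\ psi (f p) = 0 &
        forall z, Disk z -> V (f (phii z)) /\ psi (f (phii z)) = cpow z q].

(* orientation-preserving branched covering of S^2 (f only matters on S^2) *)
Definition branched_cover (f : P3 -> P3) : Prop :=
  [/\ (forall x, S2 x -> S2 (f x)), {within S2, continuous f} &
      forall p, S2 p -> exists q, (0 < q)%N /\ local_form f p q].

Definition crit (f : P3 -> P3) (p : P3) : Prop :=
  S2 p /\ exists q, (1 < q)%N /\ local_form f p q.

Definition post (f : P3 -> P3) : set P3 :=
  [set y | exists c n, crit f c /\ (0 < n)%N /\ y = iter n f c].

Definition thurston_map (f : P3 -> P3) : Prop :=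
  [/\ branched_cover f, finite_set (post f) &
      exists a b c, [/\ post f a /\ post f b /\ post f c, a <> b, a <> c & b <> c]].

Definition is_degree (F : P3 -> P3) (d : nat) : Prop :=
  (forall y, S2 y -> [set x | S2 x /\ F x = y] #<= `I_d) /\
  exists y, S2 y /\ [set x | S2 x /\ F x = y] #= `I_d.

Definition jordan_curve (C : set P3) : Prop :=
  C `<=` S2 /\ exists c : P2 -> P3,
    [/\ {within S1, continuous c},
        (forall z w, S1 z -> S1 w -> c z = c w -> z = w) & c @` S1 = C].

(* expanding: the maximal diameter (w.r.t. the metric of R^3 restricted to S^2)
   of the components of S^2 \ f^{-n}(C) tends to 0 *)
Definition expanding (f : P3 -> P3) : Prop :=
  exists C, [/\ jordan_curve C, post f `<=` C &
    forall eps : R, 0 < eps -> exists N, forall n, (N <= n)%N ->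
      forall x y z,
        let W := S2 `\` (iter n f @^-1` C) in
        W x -> connected_component W x y -> connected_component W x z ->
        `|y - z| <= eps].

End Defs.
Arguments S1 : clear implicits.
Arguments S2 : clear implicits.
Arguments Disk : clear implicits.

(* Main.v *)
Require Import Defs.
From HB Require Import structures.
From mathcomp Require Import all_boot all_order all_algebra.
From mathcomp Require Import all_classical all_reals all_analysis.
From mathcomp Require Import ring lra zify.
Import Order.TTheory GRing.Theory Num.Theory.
Import numFieldNormedType.Exports.
Local Open Scope classical_set_scope.
Local Open Scope ring_scope.

(* Write [P] for the postcritical set. The arcs of [gamma] shrink under
   backward iteration: if [f^m x] is close to [y], then pulling back a short arc
   of [gamma] ending at [y] joins [x] to a point of [f^-m y] by a set of small
   diameter. If [U] is a disc around [y] with [P] meeting [U] in [y] at most,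
   then radial contraction of [U] lifts through the iterates of [f], so that a
   connected subset of [f^-m U] contains at most one point over [y]; hence the
   components of [f^-m] of small neighbourhoods of [y] have diameter tending to
   zero. Now take a curve [C] through [P] that is a graph over a great circle in
   a generic direction [v]: both sides of [C] contract radially to [v] or [-v],
   and the same lifting argument joins each point of a component of the
   complement of [f^-m C] to a single centre by boundedly many small pieces. *)

(** Inverse branches contract because [gamma] is onto and turns [F] into [z^d]: every point lies on
    an arc of the curve, and pulling back by [F^j] divides the length of the parameter arc by [d^j].
    Here [d >= 2], since a postcritical point comes from a critical point, and [f] is not injective
    near such a point. This alone bounds no diameter: a connected set of preimages may be covered
    only by many short arcs with different end points over [y]. Uniqueness of the point over [y] is
    what turns length of arcs into diameter. Covering theory does not apply at [y] itself, which may
    be a branch value, so the lifting is built by hand from openness, discrete fibres and local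
    injectivity off [P]. Expansion may be tested on any one Jordan curve through [P]. A graph over a
    great circle gives both sides an explicit contraction, in place of an appeal to the Schoenflies
    theorem. This contraction does not depend on the iterate, hence neither does the number of small
    pieces. *)

Section EpsilonDelta.
Context {R : realType}.

(** * Continuity in epsilon-delta form, compactness and connectedness *)

Definition cts_on {V W : normedModType R} (A : set V) (f : V -> W) :=
  forall x, A x -> forall e : R, 0 < e -> exists2 d : R, 0 < d &
    forall y, A y -> `|y - x| < d -> `|f y - f x| < e.

Lemma cts_onP {V W : normedModType R} (A : set V) (f : V -> W) :
  {within A, continuous f} <-> cts_on A f.
Proof.
split.
  move/subspace_continuousP => cf x Ax e e0.
  have /= := cf x Ax _ (nbhsx_ballx (f x) _ e0).
  rewrite /within /= => /nbhs_ballP[d /= d0 H]; exists d => // y Ay yx.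
  rewrite distrC; have := H y; rewrite -!ball_normE /=.
  by apply => //; rewrite distrC.
move=> cf; apply/subspace_continuousP => x Ax; apply/cvgrPdist_lt => e e0.
have [d d0 H] := cf x Ax e e0.
rewrite near_withinE; apply/nbhs_ballP; exists d => //= y.
by rewrite -ball_normE /= distrC => yx Ay; rewrite distrC; exact: H.
Qed.

Lemma cts_onW {V W : normedModType R} (A : set V) (f : V -> W) :
  (forall x, A x -> {for x, continuous f}) -> cts_on A f.
Proof.
move=> cf; apply/cts_onP/subspace_continuousP => x Ax.
exact: cvg_within_filter (cf x Ax).
Qed.

Lemma cts_onS {V W : normedModType R} (A B : set V) (f : V -> W) :
  A `<=` B -> cts_on B f -> cts_on A f.
Proof.
move=> AB cf x Ax e e0; have [d d0 H] := cf x (AB _ Ax) e e0.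
by exists d => // y Ay; apply: H; apply: AB.
Qed.

Lemma cts_on_comp {U V W : normedModType R} (A : set U) (B : set V)
    (f : U -> V) (g : V -> W) :
  (forall x, A x -> B (f x)) -> cts_on A f -> cts_on B g -> cts_on A (g \o f).
Proof.
move=> AB cf cg x Ax e e0; have [d d0 H] := cg _ (AB _ Ax) e e0.
have [d' d'0 H'] := cf x Ax d d0; exists d' => // y Ay yx.
by apply: H; [exact: AB|exact: H'].
Qed.

Lemma cts_on_connected {V W : normedModType R} (A : set V) (f : V -> W) :
  connected A -> cts_on A f -> connected (f @` A).
Proof. by move=> cA /cts_onP; exact: connected_continuous_connected. Qed.

Lemma cts_on_compact {V W : normedModType R} (A : set V) (f : V -> W) :
  compact A -> cts_on A f -> compact (f @` A).
Proof. by move=> cA /cts_onP cf; exact: continuous_compact. Qed.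

(** Near-covering form of compactness along the filter of positive [d] tending to 0. It stands in
    for every Lebesgue number argument below. *)
Lemma compact_uniform {V : normedModType R} (K : set V) (P : R -> V -> Prop) :
  compact K -> (forall d d' x, d' <= d -> P d x -> P d' x) ->
  (forall x, K x -> exists2 d : R, 0 < d &
     forall y, K y -> `|y - x| < d -> P d y) ->
  exists2 d : R, 0 < d & forall x, K x -> P d x.
Proof.
move=> /compact_near_coveringP/near_covering_withinP cK mP locP.
have : \forall d \near (0:R)^'+, K `<=` (fun x => P d x).
  apply: (cK R _ _) => x Kx; have [d d0 H] := locP x Kx.
  have nx : \forall y \near x, `|y - x| < d.
    by apply/nbhs_ballP; exists d => //= y; rewrite -ball_normE /= distrC.
  have nd : \forall e \near (0:R)^'+, e <= d by exact: nbhs_right_le.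
  exists ([set y | `|y - x| < d], [set e | e <= d]) => // -[y e] /= [yx ed] Ky.
  by apply: (mP d) => //; exact: H.
move=> nK; have [d [d0 H]] := filter_ex (filterI (nbhs_right_gt (0:R)) nK).
by exists d.
Qed.

Lemma compact_uniform_nat {V : normedModType R} (K : set V)
    (P : nat -> V -> Prop) :
  compact K -> (forall n m x, (n <= m)%N -> P n x -> P m x) ->
  (forall x, K x -> exists n, exists2 d : R, 0 < d &
     forall y, K y -> `|y - x| < d -> P n y) ->
  exists n, forall x, K x -> P n x.
Proof.
move=> cK mP locP.
(* The index is encoded as a scale: at scale [d] the property is required for all [n] with
   [1/(n+1) <= d], which is monotone in [d]. *)
have [|x Kx|d d0 H] := @compact_uniform V K
  (fun d x => forall n, n.+1%:R^-1 <= d -> P n x) cK.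
- by move=> d d' x dd' H n nd; apply: H; exact: le_trans dd'.
- have [n [d d0 Hn]] := locP x Kx.
  exists (Num.min d n.+1%:R^-1); first by rewrite lt_min d0 /= invr_gt0.
  move=> y Ky; rewrite lt_min => /andP[yd _] m.
  rewrite le_min => /andP[_ mn]; apply: (mP n); last exact: Hn.
  by move: mn; rewrite lef_pV2 ?posrE // ler_nat ltnS.
have [n] := near_infty_natSinv_lt (PosNum d0).
move=> _ /(_ n (leqnn n)) nd; exists n => x Kx; apply: H => //; exact: ltW.
Qed.

Lemma cts_on_uniform {V W : normedModType R} (A : set V) (f : V -> W) (e : R) :
  compact A -> cts_on A f -> 0 < e ->
  exists2 d : R, 0 < d & forall x y, A x -> A y -> `|x - y| < d ->
    `|f x - f y| < e.
Proof.
move=> cA cf e0.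
have [|x Ax|d d0 H] := @compact_uniform V A
  (fun d x => forall y, A y -> `|x - y| < d -> `|f x - f y| < e) cA.
- by move=> d d' x dd' H y Ay xy; apply: H => //; exact: lt_le_trans dd'.
- have [|d d0 Hd] := cf x Ax (e / 2); first by lra.
  exists (d / 2); first by lra.
  move=> y Ay yx z Az yz.
  have h1 : `|f y - f x| < e / 2 by apply: Hd => //; lra.
  have h2 : `|f z - f x| < e / 2.
    by apply: Hd => //; have := ler_distD y z x; rewrite [`|z - y|]distrC; lra.
  by have := ler_distD (f x) (f y) (f z); rewrite [`|f x - f z|]distrC; lra.
by exists d => // x y Ax Ay; exact: H.
Qed.

Lemma connected_locally_constant {V : normedModType R} (K : set V)
    (phi : V -> Prop) :
  connected K ->
  (forall x, K x -> exists2 d : R, 0 < d &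
     forall y, K y -> `|y - x| < d -> (phi y <-> phi x)) ->
  forall x y, K x -> K y -> phi x -> phi y.
Proof.
move=> cK loc x y Kx Ky px.
(* [O psi] is a union of balls of the whole space whose trace on [K] is that of [psi]. Applied to
   [phi] and to its negation, it makes the trace of [phi] clopen in [K]. *)
pose O (psi : V -> Prop) : set V := [set z | exists a d, [/\ K a, psi a,
  (forall y, K y -> `|y - a| < d -> (psi y <-> psi a)) & `|z - a| < d]].
have opO psi : open (O psi).
  rewrite openE => z [a [d [Ka pa Ha za]]]; apply/nbhs_ballP.
  exists (d - `|z - a|) => /=; first by rewrite subr_gt0.
  move=> w; rewrite -ball_normE /= => zw; exists a, d; split => //.
  by have := ler_distD z w a; rewrite [`|w - z|]distrC; lra.
have KO psi : (forall x, K x -> exists2 d : R, 0 < d &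
     forall y, K y -> `|y - x| < d -> (psi y <-> psi x)) ->
   K `&` psi = K `&` O psi.
  move=> lp; apply/seteqP; split => z [Kz]; last first.
    by case=> a [d [Ka pa Ha za]]; split => //; apply/(Ha z).
  move=> pz; split=> //; have [d d0 H] := lp z Kz; exists z, d; split=> //.
  by rewrite subrr normr0.
have e : K `&` phi = K.
  apply: cK.
  - by exists x.
  - by exists (O phi) => //; exact: KO.
  - exists (~` O (fun z => ~ phi z)); first exact: open_closedC.
    have K1 := KO (fun z => ~ phi z).
    have {}K1 : K `&` (fun z => ~ phi z) = K `&` O (fun z => ~ phi z).
      apply: K1 => z Kz; have [d d0 H] := loc z Kz; exists d => // w Kw wz.
      by have := H w Kw wz; tauto.
    apply/seteqP; split => z [Kz pz]; split => //.
      move=> Oz; have : (K `&` (fun z => ~ phi z)) z by rewrite K1; split.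
      by case.
    apply: contrapT => npz.
    have : (K `&` O (fun z => ~ phi z)) z by rewrite -K1; split.
    by case.
have : (K `&` phi) y by rewrite e.
by case.
Qed.

End EpsilonDelta.

(** * Lifting paths and contractions through branched maps *)

Section Lifting.
Context {R : realType} {V : normedModType R}.
Local Notation unitI := (`[0, 1]%classic : set R).

(* The topological trace of a branched covering of [S] whose branch values
   lie in [P]: a continuous open map with discrete fibres which is locally
   injective over the complement of [P]. *)
Record branched_map (S P : set V) (g : V -> V) : Prop := BranchedMap {
  bm_map : forall x, S x -> S (g x) ;
  bm_cts : cts_on S g ;
  bm_open : forall b, S b -> forall r : R, 0 < r -> exists2 d : R, 0 < d &
    forall w, S w -> `|w - g b| < d -> exists z, [/\ S z, `|z - b| < r & g z = w] ;
  bm_disc : forall b, S b -> exists2 r : R, 0 < r &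
    forall z, S z -> `|z - b| < r -> g z = g b -> z = b ;
  bm_inj : forall b, S b -> ~ P (g b) -> exists2 r : R, 0 < r &
    forall z z', S z -> S z' -> `|z - b| < r -> `|z' - b| < r ->
      g z = g z' -> z = z' }.

Context {S P : set V} {g : V -> V}.
Hypotheses (cS : compact S) (bg : branched_map S P g).

Lemma branched_map_uniform_open (r : R) : 0 < r -> exists2 d : R, 0 < d &
  forall b w, S b -> S w -> `|w - g b| < d ->
    exists z, [/\ S z, `|z - b| < r & g z = w].
Proof.
move=> r0; have [|b Sb|d d0 H] := @compact_uniform _ V S (fun d b => forall w,
    S w -> `|w - g b| < d -> exists z, [/\ S z, `|z - b| < r & g z = w]) cS.
- by move=> d d' x dd' H w Sw wd; apply: H => //; exact: lt_le_trans dd'.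
- have [|d d0 Hd] := bm_open _ _ _ bg b Sb (r / 2); first by lra.
  have [|e e0 He] := bm_cts _ _ _ bg b Sb (d / 2); first by lra.
  exists (Num.min (d / 2) (Num.min e (r / 2))).
    by rewrite !lt_min; apply/and3P; split; lra.
  move=> c Sc; rewrite !lt_min => /and3P[_ ce cr] w Sw; rewrite lt_min => /andP[wc _].
  have gc := He c Sc ce.
  have [||z [Sz zb gz]] := Hd w => //.
    by have := ler_distD (g c) w (g b); lra.
  exists z; split => //.
  by have := ler_distD b z c; rewrite [`|b - c|]distrC; lra.
- by exists d => // b w Sb Sw; exact: H.
Qed.

Lemma branched_map_uniform_inj (A : set V) : closed A -> A `&` P = set0 ->
  exists2 r : R, 0 < r & forall b c, S b -> S c -> A (g b) -> `|c - b| < r ->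
    g c = g b -> c = b.
Proof.
move=> clA AP; have [|b Sb|r r0 H] := @compact_uniform _ V S (fun d b =>
    forall c, S c -> A (g b) -> `|c - b| < d -> g c = g b -> c = b) cS.
- by move=> d d' x dd' H c Sc Ab cd; apply: H => //; exact: lt_le_trans dd'.
- have [Ab|nAb] := pselect (A (g b)).
    have [|r r0 Hr] := bm_inj _ _ _ bg b Sb.
      by move=> Pb; have : (A `&` P) (g b) by []; rewrite AP.
    exists (r / 2); first by lra.
    move=> c Sc cb e Se _ ec; apply: Hr => //; last by lra.
    by have := ler_distD c e b; lra.
  have : nbhs (g b) (~` A) by apply: open_nbhs_nbhs; split => //; exact: closed_openC.
  move=> /nbhs_ballP[e /= e0 He].
  have [d d0 Hd] := bm_cts _ _ _ bg b Sb e e0.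
  exists d => // c Sc cb e' _ Ac; have := He (g c).
  by rewrite -ball_normE /= distrC => /(_ (Hd c Sc cb)).
- by exists r => // b c Sb Sc; exact: H.
Qed.

(** Any preimage of [w] within [r] of [b]; it is the only one once [r] is below the separation of
    the fibres. In [lift_chainP] openness supplies such a preimage for every parameter in [A], so
    the default [b] is not reached there. *)
Definition nearest_lift (r : R) (b w : V) : V :=
  xget b [set z | [/\ S z, `|z - b| < r & g z = w]].

Fixpoint lift_chain {T : Type} (r : R) (z0 : T -> V) (h : nat -> T -> V)
    (i : nat) (a : T) : V :=
  if i is j.+1 then nearest_lift r (lift_chain r z0 h j a) (h i a) else z0 a.

(** Homotopy lifting in discrete time: a step shorter than [d] is lifted by a jump to the nearby
    preimage. Fibres over the closed set [A0], which misses [P], are uniformly separated, and this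
    makes the jump unique and hence continuous in the parameter. As [d] depends on [g], [A0] and
    [r0] alone, the parameter set [A] may be arbitrary. *)
Lemma lift_chainP (A0 : set V) (r0 : R) :
  closed A0 -> A0 `&` P = set0 -> 0 < r0 ->
  exists2 d : R, 0 < d & forall (T : normedModType R) (A : set T)
    (z0 : T -> V) (h : nat -> T -> V),
    (forall a, A a -> S (z0 a)) -> cts_on A z0 ->
    (forall a, A a -> g (z0 a) = h 0%N a) ->
    (forall i, cts_on A (h i)) ->
    (forall i a, A a -> S (h i a) /\ A0 (h i a)) ->
    (forall i a, A a -> `|h i.+1 a - h i a| < d) ->
    exists z : nat -> T -> V, [/\ z 0%N = z0,
      forall i, cts_on A (z i),
      forall i a, A a -> S (z i a) /\ g (z i a) = h i a,
      forall i a, A a -> `|z i.+1 a - z i a| < r0 &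
      forall i a, A a -> h i.+1 a = h i a -> z i.+1 a = z i a].
Proof.
move=> clA AP r00.
have [s s0 Hs] := branched_map_uniform_inj A0 clA AP.
(* Lifts at neighbouring parameters are compared through four distances below [r], whose sum has to
   stay below the separation [s]. *)
pose r := Num.min r0 (s / 4).
have r_gt0 : 0 < r by rewrite lt_min r00 /=; lra.
have rs : r <= s / 4 by rewrite ge_min lexx orbT.
have rr0 : r <= r0 by rewrite ge_min lexx.
have [d d0 Hd] := branched_map_uniform_open r r_gt0.
exists d => // T A z0 h Sz0 cz0 gz0 ch Sh hd.
pose z := lift_chain r z0 h.
have zP i a : A a -> S (z i a) /\ g (z i a) = h i a.
  elim: i => [|i IH] Aa; first by split; [exact: Sz0|exact: gz0].
  have [Szi gzi] := IH Aa.
  have [] : [set w | [/\ S w, `|w - z i a| < r & g w = h i.+1 a]] (z i.+1 a).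
    apply: xgetPex; apply: Hd => //; first by case: (Sh i.+1 a Aa).
    by rewrite gzi; exact: hd.
  by [].
have zr i a : A a -> `|z i.+1 a - z i a| < r.
  move=> Aa; have [Szi gzi] := zP i a Aa.
  have [] : [set w | [/\ S w, `|w - z i a| < r & g w = h i.+1 a]] (z i.+1 a).
    apply: xgetPex; apply: Hd => //; first by case: (Sh i.+1 a Aa).
    by rewrite gzi; exact: hd.
  by [].
exists z; split => //.
- elim=> [|i IH] //; move=> a Aa e e0.
  pose e' := Num.min e r.
  have e'0 : 0 < e' by rewrite lt_min e0.
  have e'e : e' <= e by rewrite ge_min lexx.
  have e'r : e' <= r by rewrite ge_min lexx orbT.
  have [d1 d10 Hd1] := branched_map_uniform_open e' e'0.
  have [d2 d20 Hd2] := ch i.+1 a Aa d1 d10.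
  have [d3 d30 Hd3] := IH a Aa r r_gt0.
  exists (Num.min d2 d3); first by rewrite lt_min d20.
  move=> b Ab; rewrite lt_min => /andP[bd2 bd3].
  have [Sza gza] := zP i.+1 a Aa; have [Szb gzb] := zP i.+1 b Ab.
  have [Shb Ahb] := Sh i.+1 b Ab.
  have [||w [Sw wz gw]] := Hd1 (z i.+1 a) (h i.+1 b) Sza => //.
    by rewrite gza; exact: Hd2.
  (* Both points lie over [h i.+1 b], which is in [A0], and are less than [s] apart. *)
  have -> : z i.+1 b = w; last by lra.
  apply: Hs => //; [by rewrite gw| |by rewrite gw].
  have := zr i a Aa; have := zr i b Ab; have := Hd3 b Ab bd3.
  have := ler_distD (z i b) (z i.+1 b) w.
  have := ler_distD (z i a) (z i b) w.
  have := ler_distD (z i.+1 a) (z i a) w.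
  rewrite [`|z i a - z i.+1 a|]distrC [`|z i.+1 a - w|]distrC; lra.
- by move=> i a Aa; apply: lt_le_trans rr0; exact: zr.
- move=> i a Aa hh; have [Sz gz] := zP i a Aa; have [Sz' gz'] := zP i.+1 a Aa.
  apply: Hs => //; first by rewrite gz; case: (Sh i a Aa).
    by have := zr i a Aa; lra.
  by rewrite gz gz'.
Qed.

Lemma mesh_exists (e : R) : 0 < e -> exists2 N : nat, (0 < N)%N & N%:R^-1 < e.
Proof.
move=> e0; have [n] := near_infty_natSinv_lt (PosNum e0).
by move=> _ /(_ n (leqnn n)) nd; exists n.+1.
Qed.

(** Time is sampled in steps of [1/N] and frozen from step [N] on by [minn], so that a finite
    subdivision can be indexed by all natural numbers. *)
Lemma mesh_itv (N i : nat) (s : R) : (0 < N)%N -> 0 <= s <= 1 ->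
  0 <= (minn i N)%:R * s / N%:R <= s.
Proof.
move=> N0 /andP[s0 s1]; have N0' : (0:R) < N%:R by rewrite ltr0n.
apply/andP; split; first by rewrite divr_ge0 // mulr_ge0.
by rewrite ler_pdivrMr // mulrC ler_wpM2l // ler_nat geq_minr.
Qed.

Lemma mesh_step (N i : nat) (s : R) : (0 < N)%N -> 0 <= s <= 1 ->
  `|(minn i.+1 N)%:R * s / N%:R - (minn i N)%:R * s / N%:R| <= N%:R^-1.
Proof.
move=> N0 /andP[s0 s1]; have N0' : (0:R) < N%:R by rewrite ltr0n.
have [->|->] : minn i.+1 N = (minn i N).+1 \/ minn i.+1 N = minn i N by lia.
  rewrite -natr1 mulrDl mulrDl addrAC subrr add0r mul1r ger0_norm.
    by rewrite ler_pdivrMr // mulVf ?lt0r_neq0.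
  by rewrite divr_ge0.
by rewrite subrr normr0 invr_ge0.
Qed.

(** The parameter of the chain is the time [t] itself: stage [i] lifts the slowed path
    [p (i t / N)]. Stage 0 is the constant [k], stage [N] lifts [p], and at [t = 0] nothing moves,
    so the last clause of [lift_chainP] keeps the value [k]. *)
Lemma path_lift (p : R -> V) (k : V) :
  cts_on unitI p -> (forall t : R, 0 <= t <= 1 -> S (p t) /\ ~ P (p t)) ->
  S k -> g k = p 0 ->
  exists q : R -> V, [/\ cts_on unitI q, q 0 = k &
    forall t : R, 0 <= t <= 1 -> S (q t) /\ g (q t) = p t].
Proof.
move=> cp Sp Sk gk.
have cA : compact (p @` unitI) by apply: cts_on_compact => //; exact: segment_compact.
have clA : closed (p @` unitI) by apply: compact_closed => //; exact: norm_hausdorff.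
have AP : p @` unitI `&` P = set0.
  rewrite -subset0 => _ [[t /= t01 <-] Pt]; move: t01; rewrite in_itv /= => t01.
  by case: (Sp t t01).
have [d d0 Hd] := lift_chainP _ _ clA AP (ltr01 : (0:R) < 1).
have [e e0 He] := cts_on_uniform _ p d (@segment_compact R 0 1) cp d0.
have [N N0 Ne] := mesh_exists e e0.
have N0' : (0:R) < N%:R by rewrite ltr0n.
have I01 i (t : R) : 0 <= t <= 1 -> 0 <= (minn i N)%:R * t / N%:R <= 1.
  by move=> t01; have /andP[-> h] := mesh_itv N i t N0 t01; case/andP: t01 => _; lra.
have [|||||i t|z [z0 cz zP _ zst]] :=
  Hd R unitI (fun=> k) (fun i t => p ((minn i N)%:R * t / N%:R)).
- by [].
- by move=> x _ e1 e10; exists 1 => // y _ _; rewrite subrr normr0.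
- by move=> a _; rewrite min0n !mul0r.
- move=> i; apply: (@cts_on_comp _ R R V _ unitI (fun t => (minn i N)%:R * t / N%:R)) => //.
    by move=> t /=; rewrite !in_itv /=; exact: I01.
  apply: cts_onW => t _; apply: cvgM; last exact: cvg_cst.
  by apply: cvgM; [exact: cvg_cst|exact: cvg_id].
- move=> i t /=; rewrite in_itv /= => t01; split; first by case: (Sp _ (I01 i t t01)).
  by exists ((minn i N)%:R * t / N%:R) => //; rewrite /= in_itv /=; exact: I01.
- rewrite /= in_itv /= => t01; apply: He; rewrite /= ?in_itv /=; try exact: I01.
  by apply: le_lt_trans Ne; exact: mesh_step.
exists (z N); split => //.
  have z00 : unitI (0 : R) by rewrite /= in_itv /= lexx ler01.
  suff: forall i, z i 0 = k by [].
  by elim=> [|i <-]; [rewrite z0|apply: zst => //; rewrite !mulr0 !mul0r].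
move=> t t01; have [|Sz gz] := zP N t; first by rewrite /= in_itv.
by split => //; rewrite gz minnn mulrAC mulfV ?mul1r // lt0r_neq0.
Qed.

(** Discreteness of fibres suffices for one fixed [y], so branch values are allowed here, unlike in
    [branched_map_uniform_inj]. *)
Lemma fibre_separated (y : V) : exists2 r : R, 0 < r &
  forall x x', S x -> S x' -> g x = y -> g x' = y -> `|x' - x| < r -> x' = x.
Proof.
have [|b Sb|r r0 H] := @compact_uniform _ V S (fun d b => forall c, S c ->
    g b = y -> g c = y -> `|c - b| < d -> c = b) cS.
- by move=> d d' x dd' H c Sc gb gc cd; apply: H => //; exact: lt_le_trans dd'.
- have [gb|gb] := pselect (g b = y).
    have [r r0 Hr] := bm_disc _ _ _ bg b Sb.
    exists (r / 2); first by lra.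
    move=> c Sc cb e Se gc ge ec.
    have -> : c = b by apply: Hr => //; [lra|rewrite gc].
    apply: Hr => //; last by rewrite ge.
    by have := ler_distD c e b; lra.
  have gb0 : 0 < `|y - g b| by rewrite normr_gt0 subr_eq0; apply/eqP => /esym.
  have [d d0 Hd] := bm_cts _ _ _ bg b Sb _ gb0.
  by exists d => // c Sc cb e Se gc; have := Hd c Sc cb; rewrite gc ltxx.
- by exists r => // x x' Sx Sx' gx gx'; exact: H.
Qed.

Lemma preimage_near_fibre (y : V) (r : R) : 0 < r -> exists2 d : R, 0 < d &
  forall b, S b -> `|g b - y| < d -> exists x, [/\ S x, g x = y & `|b - x| < r].
Proof.
move=> r0; have [|b Sb|d d0 H] := @compact_uniform _ V S (fun d b =>
    `|g b - y| < d -> exists x, [/\ S x, g x = y & `|b - x| < r]) cS.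
- by move=> d d' x dd' H gd; apply: H => //; exact: lt_le_trans dd'.
- have [gb|gb] := pselect (g b = y).
    by exists r => // c Sc cb _; exists b.
  have gb0 : 0 < `|g b - y| by rewrite normr_gt0 subr_eq0; apply/eqP.
  have [|d d0 Hd] := bm_cts _ _ _ bg b Sb (`|g b - y| / 2); first by lra.
  exists (Num.min d (`|g b - y| / 2)); first by rewrite lt_min d0; lra.
  move=> c Sc; rewrite !lt_min => /andP[cb _] /andP[_ gc].
  have := Hd c Sc cb; have := ler_distD (g c) (g b) y.
  by rewrite [`|g b - g c|]distrC; lra.
- by exists d.
Qed.

(* A contraction of [D] onto [y] lifts to a retraction of the preimage of [D]
   onto the fibre of [y]. Since [y] may be a branch value, only the part of the
   contraction away from [y] is lifted, and it is followed by the assignment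
   of the nearest point in the fibre. *)
Lemma unique_centre (D : set V) (y : V) (H : V -> R -> V) :
  compact D -> D `<=` S ->
  cts_on (D `*` unitI) (fun ut => H ut.1 ut.2) ->
  (forall u, D u -> H u 0 = u) -> (forall u, D u -> H u 1 = y) ->
  (forall t : R, 0 <= t <= 1 -> H y t = y) ->
  (forall u (t : R), D u -> 0 <= t <= 1 -> S (H u t)) ->
  (forall u (t : R), D u -> u <> y -> 0 <= t < 1 -> ~ P (H u t)) ->
  forall K, connected K -> K `<=` S -> (forall k, K k -> D (g k)) ->
  forall x x', K x -> K x' -> g x = y -> g x' = y -> x = x'.
Proof.
move=> cD DS cH H0 H1 Hy SH PH K cK KS KD x1 x2 Kx1 Kx2 gx1 gx2.
have Dy : D y by rewrite -gx1; exact: KD.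
have [r1 r10 sep] := fibre_separated y.
(* Distinct points over [y] are at least [4 r0] apart, so a jump shorter than [r0] cannot lead from
   the [r0]-ball of one of them to that of another. *)
pose r0 := r1 / 4; have r00 : 0 < r0 by rewrite /r0; lra.
have [ze ze0 near_fib] := preimage_near_fibre y r0 r00.
have cDI : compact (D `*` unitI) by apply: compact_setX => //; exact: segment_compact.
have [et et0 Het] := cts_on_uniform _ _ ze cDI cH ze0.
have I01 t : (0:R) <= t <= 1 -> unitI t by rewrite /= in_itv.
have normP (u u' : V) (t t' : R) (e : R) : `|u - u'| < e -> `|t - t'| < e ->
    `|(u, t) - (u', t')| < e.
  by move=> h1 h2; rewrite prod_normE /= gt_max h1 h2.
have zone1 u t : D u -> `|u - y| < et -> 0 <= t <= 1 -> `|H u t - y| < ze.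
  move=> Du uy t01; rewrite -(Hy t t01).
  apply: (Het (u, t) (y, t)); [by split; [|exact: I01]|by split=> //; exact: I01|].
  by apply: normP => //; rewrite subrr normr0.
(* The contraction is stopped before time 1, where it may meet [P], but so late that every [H u T]
   is within [ze] of [y] and its lifts are near the fibre. *)
pose T : R := 1 - Num.min et 1 / 2.
have m1 : Num.min et 1 <= 1 by rewrite ge_min lexx orbT.
have m2 : Num.min et 1 <= et by rewrite ge_min lexx.
have m0 : 0 < Num.min et 1 by rewrite lt_min et0 ltr01.
have TE : 1 - T = Num.min et 1 / 2 by rewrite /T; lra.
move: (Num.min et 1) m1 m2 m0 T TE => m m1 m2 m0 T TE.
have T01 : 0 <= T <= 1 by apply/andP; split; lra.
have T1 : T < 1 by lra.
have [Tge0 Tle1] := andP T01.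
have zone2 u : D u -> `|H u T - y| < ze.
  move=> Du; rewrite -(H1 u Du).
  apply: (Het (u, T) (u, 1)); [by split; [|exact: I01]| |].
    by split=> //; apply: I01; rewrite ler01 lexx.
  apply: normP; rewrite ?subrr ?normr0 //.
  by rewrite distrC ger0_norm; lra.
(* Away from [y] the track up to time [T] is compact and misses [P], as [lift_chainP] requires. *)
pose A := D `&` [set u | et / 2 <= `|u - y|].
have clN : closed [set u : V | et / 2 <= `|u - y|].
  apply: (@closed_comp _ _ (fun u : V => `|u - y|) [set t | et / 2 <= t]); last exact: closed_ge.
  by move=> u _; apply: cvg_norm; apply: cvgB; [exact: cvg_id|exact: cvg_cst].
have cA : compact A.
  apply: (subclosed_compact _ cD); last by move=> ? [].
  by apply: closedI => //; apply: compact_closed => //; exact: norm_hausdorff.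
pose A0 := (fun ut : V * R => H ut.1 ut.2) @` (A `*` (`[0, T]%classic : set R)).
have AT : A `*` (`[0, T]%classic : set R) `<=` D `*` unitI.
  move=> [u t] /= [[Du _]]; rewrite !in_itv /= => /andP[t0 tT].
  by split=> //; apply/andP; split; lra.
have cA0 : compact A0.
  apply: cts_on_compact; first by apply: compact_setX => //; exact: segment_compact.
  exact: cts_onS cH.
have clA0 : closed A0 by apply: compact_closed => //; exact: norm_hausdorff.
have A0P : A0 `&` P = set0.
  rewrite -subset0 => _ [[[u t] /= [[Du uy]] + <-]]; rewrite in_itv /= => /andP[t0 tT].
  apply: PH => //; last by apply/andP; split; lra.
  by move=> uy'; move: uy; rewrite uy' /= subrr normr0; lra.
have [d d0 Hd] := lift_chainP _ _ clA0 A0P r00.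
have [e e0 He] := cts_on_uniform _ _ d cDI cH d0.
have [N N0 Ne] := mesh_exists e e0.
have N0' : (0:R) < N%:R by rewrite ltr0n.
have Ti i : 0 <= (minn i N)%:R * T / N%:R <= T by exact: mesh_itv.
have Ti1 i : 0 <= (minn i N)%:R * T / N%:R <= 1.
  by have /andP[-> h] := Ti i; exact: le_trans Tle1.
pose E := S `&` [set k | A (g k)].
have [|||i|i k|i k|z [z0 cz zP zr _]] :=
  Hd V E id (fun i k => H (g k) ((minn i N)%:R * T / N%:R)).
- by move=> k [].
- by move=> k _ e1 e10; exists e1.
- by move=> k [_ [Dk _]]; rewrite min0n !mul0r H0.
- move=> k [Sk [Dk kA]] e1 e10.
  have [|d1 d10 Hd1] := cH (g k, (minn i N)%:R * T / N%:R) _ e1 e10.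
    by split=> /=; [|rewrite in_itv /=; exact: Ti1].
  have [d2 d20 Hd2] := bm_cts _ _ _ bg k Sk d1 d10; exists d2 => // k' [Sk' [Dk' kA']] kk'.
  apply: (Hd1 (g k', (minn i N)%:R * T / N%:R)).
    by split=> /=; [|rewrite in_itv /=; exact: Ti1].
  by apply: normP; [exact: Hd2|rewrite subrr normr0].
- move=> [Sk Ak]; split; first by apply: SH => //; case: Ak.
  by exists (g k, (minn i N)%:R * T / N%:R) => //; split => //; rewrite /= in_itv /=; exact: Ti.
- move=> [Sk [Dk Ak]]; apply: (He (g k, _) (g k, _)).
  + by split=> /=; [|rewrite in_itv /=; exact: Ti1].
  + by split=> /=; [|rewrite in_itv /=; exact: Ti1].
  apply: normP; first by rewrite subrr normr0.
  by apply: le_lt_trans Ne; exact: mesh_step.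
have same b b' : (exists x, [/\ S x, g x = y & `|b' - x| < r0]) ->
    `|b' - b| < r0 -> `|b - x1| < r0 -> `|b' - x1| < r0.
  move=> [x [Sx gx b'x]] bb' bx1.
  suff -> : x1 = x by [].
  apply: (sep x) => //; first exact: KS.
  have := ler_distD b x1 x; have := ler_distD b' b x.
  by rewrite [`|x1 - b|]distrC [`|b - b'|]distrC; rewrite /r0 in bb' bx1 b'x; lra.
(* On the overlap of the two zones, the nearest fibre point of [k] and that of its lifted end point
   agree: the whole lift stays near the fibre, and its jumps are shorter than [r0]. *)
have agree k : S k -> D (g k) -> et / 2 <= `|g k - y| < et ->
    (`|k - x1| < r0 <-> `|z N k - x1| < r0).
  move=> Sk Dk /andP[k1 k2]; have Ek : E k by [].
  have fib i : exists x, [/\ S x, g x = y & `|z i k - x| < r0].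
    have [Szi gzi] := zP i k Ek; apply: near_fib => //.
    by rewrite gzi; apply: zone1 => //; have := Ti i; lra.
  have {}z0 : z 0%N k = k by rewrite z0.
  have st i : `|z i k - x1| < r0 <-> `|z i.+1 k - x1| < r0.
    by split; apply: (same _ _ (fib _)); rewrite 1?[`|z i k - z i.+1 k|]distrC; exact: zr.
  suff : forall i, `|k - x1| < r0 <-> `|z i k - x1| < r0 by [].
  by elim=> [|i IH]; rewrite ?z0 // IH.
have rigid b : S b -> (exists x, [/\ S x, g x = y & `|b - x| < r0]) ->
   exists2 d : R, 0 < d & forall b', `|b' - b| < d ->
     (`|b' - x1| < r0 <-> `|b - x1| < r0).
  move=> Sb [x [Sx gx bx]]; exists (r0 - `|b - x|); first by lra.
  move=> b' b'b.
  have b'x : `|b' - x| < r0 by have := ler_distD b b' x; lra.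
  have [->|xx1] := pselect (x1 = x); first by split.
  have far c : `|c - x| < r0 -> ~ `|c - x1| < r0.
    move=> cx cx1; apply: xx1; apply: (sep x) => //; first exact: KS.
    have := ler_distD c x1 x; rewrite [`|x1 - c|]distrC.
    by rewrite /r0 in cx cx1; lra.
  by split => h; exfalso; move: h; apply: far.
(* [phi k] says that the retraction sends [k] to [x1]: directly if [g k] is near [y], through the
   lifted contraction otherwise. It is locally constant on [K] and true at [x1], hence true at
   [x2]. *)
pose phi k := (`|g k - y| < et /\ `|k - x1| < r0) \/
  (et <= `|g k - y| /\ `|z N k - x1| < r0).
have phi1 k : `|g k - y| < et -> (phi k <-> `|k - x1| < r0).
  by move=> k1; split=> [[[]//|[]]|]; [lra|left].
have phi2 k : S k -> D (g k) -> et / 2 <= `|g k - y| -> (phi k <-> `|z N k - x1| < r0).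
  move=> Sk Dk k1; have [k2|k2] := ltP `|g k - y| et.
    by rewrite phi1 // agree // k1.
  by split=> [[[]|[]//]|]; [lra|right].
have phix1 : phi x1 by apply/phi1; rewrite ?gx1 subrr normr0.
suff /phi1 : phi x2.
  rewrite gx2 subrr normr0 => /(_ et0) x21; apply/esym; apply: sep => //; try exact: KS.
  by rewrite /r0 in x21; lra.
move: (phix1); apply: (connected_locally_constant K) => // k Kk.
have Sk := KS k Kk; have Dk := KD k Kk.
have [k1|k1] := ltP `|g k - y| et.
  have [|d1 d10 Hd1] := bm_cts _ _ _ bg k Sk (et - `|g k - y|); first by lra.
  have [|d2 d20 Hd2] := rigid k Sk.
    apply: near_fib => //; rewrite -(H0 _ Dk).
    by apply: zone1 => //; rewrite lexx ler01.
  exists (Num.min d1 d2); first by rewrite lt_min d10.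
  move=> k' Kk'; rewrite lt_min => /andP[kd1 kd2].
  rewrite phi1; last first.
    by have := Hd1 k' (KS _ Kk') kd1; have := ler_distD (g k) (g k') y; lra.
  by rewrite phi1 //; exact: Hd2.
have Ek : E k by split=> //; split=> //=; lra.
have [Sz gz] := zP N k Ek.
have [|d2 d20 Hd2] := rigid (z N k) Sz.
  apply: near_fib => //.
  by rewrite gz minnn mulrAC mulfV ?mul1r ?lt0r_neq0 //; exact: zone2.
have [|d1 d10 Hd1] := bm_cts _ _ _ bg k Sk (et / 2); first by lra.
have [d3 d30 Hd3] := cz N k Ek d2 d20.
exists (Num.min d1 d3); first by rewrite lt_min d10.
move=> k' Kk'; rewrite lt_min => /andP[kd1 kd3].
have Sk' := KS k' Kk'; have Dk' := KD k' Kk'.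
have k'1 : et / 2 <= `|g k' - y|.
  have := Hd1 k' Sk' kd1; have := ler_distD (g k') (g k) y.
  by rewrite [`|g k - g k'|]distrC; lra.
rewrite phi2 // phi2 //; last by lra.
by apply: Hd2; apply: Hd3.
Qed.

End Lifting.

(** * Radial contractions and caps of the sphere *)

Section Sphere.
Context {R : realType}.
Local Notation P3 := 'rV[R]_3.
Local Notation unitI := (`[0, 1]%classic : set R).

Lemma c3D (x y : P3) i : c3 (x + y) i = c3 x i + c3 y i.
Proof. by rewrite /c3 mxE. Qed.

Lemma c3Z (a : R) (x : P3) i : c3 (a *: x) i = a * c3 x i.
Proof. by rewrite /c3 mxE. Qed.

Lemma c3N (x : P3) i : c3 (- x) i = - c3 x i.
Proof. by rewrite /c3 mxE. Qed.

Lemma c3_0 i : c3 (0 : P3) i = 0.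
Proof. by rewrite /c3 mxE. Qed.

Lemma c3_mk3 (a b c : R) :
  (c3 (mk3 a b c) 0 = a) * (c3 (mk3 a b c) 1 = b) * (c3 (mk3 a b c) 2 = c).
Proof. by rewrite /c3 /mk3 !mxE /= !inordK. Qed.

Lemma c3_inj (x y : P3) :
  c3 x 0 = c3 y 0 -> c3 x 1 = c3 y 1 -> c3 x 2 = c3 y 2 -> x = y.
Proof.
move=> h0 h1 h2; apply/rowP => i; rewrite -(inord_val i).
by case: i => -[|[|[|//]]] ?.
Qed.

Local Notation c3E := (c3D, c3Z, c3N, c3_0, c3_mk3).

Lemma mk3E (a b c : R) :
  mk3 a b c = a *: mk3 1 0 0 + b *: mk3 0 1 0 + c *: mk3 0 0 1.
Proof. by apply: c3_inj; rewrite !c3E; lra. Qed.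

Lemma c3_continuous i : continuous (fun x : P3 => c3 x i).
Proof. exact: coord_continuous. Qed.

Definition dot (x y : P3) : R :=
  c3 x 0 * c3 y 0 + c3 x 1 * c3 y 1 + c3 x 2 * c3 y 2.

Lemma S2E (x : P3) : S2 R x = (dot x x = 1).
Proof. by rewrite /S2 /= /dot -!expr2. Qed.

Lemma dot_ge0 (x : P3) : 0 <= dot x x.
Proof. by rewrite /dot -!expr2 !addr_ge0 // sqr_ge0. Qed.

Lemma dot_eq0 (x : P3) : dot x x = 0 -> x = 0.
Proof.
rewrite /dot -!expr2 => h.
have := sqr_ge0 (c3 x 0); have := sqr_ge0 (c3 x 1); have := sqr_ge0 (c3 x 2).
move=> h2 h1 h0.
by apply: c3_inj; rewrite c3_0; apply/eqP; rewrite -sqrf_eq0; apply/eqP; lra.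
Qed.

Lemma dot_gt0 (x : P3) : x <> 0 -> 0 < dot x x.
Proof.
by move=> x0; rewrite lt0r dot_ge0 andbT; apply/eqP => /dot_eq0.
Qed.

Lemma dotZl a (x y : P3) : dot (a *: x) y = a * dot x y.
Proof. by rewrite /dot !c3E; ring. Qed.

Lemma dotZr a (x y : P3) : dot x (a *: y) = a * dot x y.
Proof. by rewrite /dot !c3E; ring. Qed.

Lemma dotDl (x x' y : P3) : dot (x + x') y = dot x y + dot x' y.
Proof. by rewrite /dot !c3E; ring. Qed.

Lemma dotC (x y : P3) : dot x y = dot y x.
Proof. by rewrite /dot; ring. Qed.

Lemma dot_continuous (y : P3) : continuous (fun x : P3 => dot x y).
Proof.
have M i : continuous (fun x : P3 => c3 x i * c3 y i).
  by move=> x; exact: (cvgM (c3_continuous i x) (cvg_cst _)).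
by move=> x; exact: (cvgD (cvgD (M 0%N x) (M 1%N x)) (M 2%N x)).
Qed.

Lemma dot_self_continuous : continuous (fun x : P3 => dot x x).
Proof.
have M i : continuous (fun x : P3 => c3 x i * c3 x i).
  by move=> x; exact: (cvgM (c3_continuous i x) (c3_continuous i x)).
by move=> x; exact: (cvgD (cvgD (M 0%N x) (M 1%N x)) (M 2%N x)).
Qed.

Lemma S2_neq0 (x : P3) : S2 R x -> x <> 0.
Proof. by rewrite S2E /dot => + x0; rewrite x0 !c3E; lra. Qed.

Lemma S2_compact : compact (S2 R).
Proof.
have cB : compact [set v : P3 | forall i, (`[-1, 1]%classic : set R) (v ord0 i)].
  exact: (rV_compact (fun i => @segment_compact R (-1) 1)).
apply: (subclosed_compact _ cB).
  have -> : S2 R = (fun x : P3 => dot x x) @^-1` [set 1].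
    by apply/seteqP; split => x; rewrite S2E.
  apply: (@closed_comp _ _ (fun x : P3 => dot x x) [set 1]); last exact: closed_eq.
  by move=> x _; exact: dot_self_continuous.
move=> x; rewrite S2E /dot /= => h i; rewrite in_itv /=.
have -> : x ord0 i = c3 x i by rewrite /c3 inord_val.
case: i => -[|[|[|//]]] ? /=; nra.
Qed.

Definition nrm (x : P3) : P3 := (Num.sqrt (dot x x))^-1 *: x.

Lemma nrm_S2 (x : P3) : x <> 0 -> S2 R (nrm x).
Proof.
move=> /dot_gt0 x0; rewrite S2E dotZl dotZr mulrA -expr2 exprVn sqr_sqrtr ?ltW //.
by rewrite mulVf // lt0r_neq0.
Qed.

Lemma nrm_id (x : P3) : S2 R x -> nrm x = x.
Proof. by rewrite S2E /nrm => ->; rewrite sqrtr1 invr1 scale1r. Qed.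

Lemma nrmZ a (x : P3) : 0 < a -> nrm (a *: x) = nrm x.
Proof.
move=> a0; rewrite /nrm dotZl dotZr mulrA -expr2 sqrtrM ?sqr_ge0 // sqrtr_sqr.
by rewrite gtr0_norm // invfM scalerA mulrAC mulVf ?mul1r // lt0r_neq0.
Qed.

Lemma nrm_scale (x : P3) : x <> 0 -> exists2 a : R, 0 < a & nrm x = a *: x.
Proof.
by move=> /dot_gt0 x0; exists (Num.sqrt (dot x x))^-1; rewrite // invr_gt0 sqrtr_gt0.
Qed.

Lemma nrm_continuous (x : P3) : x <> 0 -> {for x, continuous nrm}.
Proof.
move=> /dot_gt0 x0.
have sx : Num.sqrt (dot x x) != 0 by rewrite lt0r_neq0 // sqrtr_gt0.
have cs : {for x, continuous (fun x : P3 => Num.sqrt (dot x x))}.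
  apply: (@continuous_comp _ _ _ (fun x : P3 => dot x x) Num.sqrt).
    exact: dot_self_continuous.
  exact: sqrt_continuous.
exact: (cvgZ (cvgV sx cs) cvg_id).
Qed.

(** The chord from [x] to [v], projected from the origin to the sphere. As [v] need not be a unit
    vector, the end point is [nrm v]. *)
Definition rad (v x : P3) (t : R) : P3 := nrm ((1 - t) *: x + t *: v).

Lemma rad0 v x : S2 R x -> rad v x 0 = x.
Proof. by move=> Sx; rewrite /rad subr0 scale1r scale0r addr0 nrm_id. Qed.

Lemma rad1 v x : rad v x 1 = nrm v.
Proof. by rewrite /rad subrr scale0r scale1r add0r. Qed.

Lemma rad_nrm v t : v <> 0 -> 0 <= t <= 1 -> rad v (nrm v) t = nrm v.
Proof.
move=> v0 /andP[t0 t1]; have [a a0 e] := nrm_scale v v0.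
rewrite /rad {1}e scalerA -scalerDl nrmZ //.
have [t1'|t1'] := ltP t 1; first by nra.
by have -> : t = 1; lra.
Qed.

Lemma rad_cts (D : set P3) v :
  (forall x (t : R), D x -> 0 <= t <= 1 -> (1 - t) *: x + t *: v <> 0) ->
  cts_on (D `*` unitI) (fun ut : P3 * R => rad v ut.1 ut.2).
Proof.
move=> nz; apply: cts_onW => -[x t] [/= Dx]; rewrite in_itv /= => t01.
apply: (@continuous_comp _ _ _
  (fun ut : P3 * R => (1 - ut.2) *: ut.1 + ut.2 *: v) nrm); last first.
  by apply: nrm_continuous; exact: nz.
exact: (cvgD (cvgZ (cvgB (cvg_cst _) cvg_snd) cvg_fst) (cvgZ cvg_snd (cvg_cst _))).
Qed.

Lemma rad_cts1 v x :
  (forall t : R, 0 <= t <= 1 -> (1 - t) *: x + t *: v <> 0) ->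
  cts_on unitI (rad v x).
Proof.
move=> nz; apply: cts_onW => t; rewrite /= in_itv /= => t01.
apply: (@continuous_comp _ _ _ (fun t : R => (1 - t) *: x + t *: v) nrm); last first.
  by apply: nrm_continuous; exact: nz.
exact: (cvgD (cvgZ (cvgB (cvg_cst _) cvg_id) (cvg_cst _)) (cvgZ cvg_id (cvg_cst _))).
Qed.

Lemma S2_locally_connected (k : P3) (r : R) : S2 R k -> 0 < r ->
  exists2 d : R, 0 < d & forall k', S2 R k' -> `|k' - k| < d ->
    exists Q : set P3, [/\ connected Q, Q `<=` S2 R, Q k, Q k' &
      forall q, Q q -> `|q - k| < r].
Proof.
move=> Sk r0; have k0 := S2_neq0 k Sk.
have ck : cts_on [set w : P3 | w <> 0] nrm by apply: cts_onW => x; exact: nrm_continuous.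
have [d d0 Hd] := ck k k0 r r0.
have nk0 : 0 < `|k| by rewrite normr_gt0; apply/eqP.
(* The bound by the norm of [k] keeps the chord from [k'] to [k] away from the origin. *)
exists (Num.min d `|k|); first by rewrite lt_min d0.
move=> k' Sk'; rewrite lt_min => /andP[k'd k'k].
have dist (t : R) : 0 <= t <= 1 -> `|(1 - t) *: k' + t *: k - k| <= `|k' - k|.
  move=> /andP[t0 t1].
  have -> : (1 - t) *: k' + t *: k - k = (1 - t) *: (k' - k).
    by rewrite scalerBr [(1 - t) *: k]scalerBl scale1r -addrA opprB.
  rewrite normrZ ger0_norm; last by lra.
  by have := normr_ge0 (k' - k); nra.
have nz (t : R) : 0 <= t <= 1 -> (1 - t) *: k' + t *: k <> 0.
  by move=> /dist + e; rewrite e sub0r normrN; lra.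
exists (rad k k' @` unitI); split.
- apply: cts_on_connected; first exact: segment_connected.
  exact: rad_cts1.
- by move=> _ [t /= + <-]; rewrite in_itv /= => t01; apply: nrm_S2; exact: nz.
- by exists 1; rewrite /= ?in_itv /= ?ler01 ?lexx // rad1 nrm_id.
- by exists 0; rewrite /= ?in_itv /= ?ler01 ?lexx // rad0.
- move=> _ [t /= + <-]; rewrite in_itv /= => t01.
  rewrite -{2}(nrm_id k Sk); apply: Hd; first exact: nz.
  by apply: le_lt_trans k'd; exact: dist.
Qed.

Lemma unique_centre_rad (P : set P3) g (D : set P3) (v : P3) :
  branched_map (S2 R) P g -> compact D -> D `<=` S2 R -> v <> 0 ->
  (forall x (t : R), D x -> 0 <= t <= 1 -> (1 - t) *: x + t *: v <> 0) ->
  (forall x (t : R), D x -> x <> nrm v -> 0 <= t < 1 -> ~ P (rad v x t)) ->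
  forall K, connected K -> K `<=` S2 R -> (forall k, K k -> D (g k)) ->
  forall x x', K x -> K x' -> g x = nrm v -> g x' = nrm v -> x = x'.
Proof.
move=> bg cD DS v0 nz nP K cK KS KD x x' Kx Kx' gx gx'.
apply: (unique_centre S2_compact bg D (nrm v) (rad v) _ _ _ _ _ _ _ _ K) => //.
- exact: rad_cts.
- by move=> u Du; rewrite rad0 //; exact: DS.
- by move=> u Du; rewrite rad1.
- by move=> t t01; rewrite rad_nrm.
- by move=> u t Du t01; apply: nrm_S2; exact: nz.
Qed.

Lemma dot_le1 (x y : P3) : S2 R x -> S2 R y -> dot x y <= 1.
Proof.
rewrite !S2E /dot => hx hy.
have := sqr_ge0 (c3 x 0 - c3 y 0); have := sqr_ge0 (c3 x 1 - c3 y 1).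
by have := sqr_ge0 (c3 x 2 - c3 y 2); nra.
Qed.

Lemma dot_eq1 (x y : P3) : S2 R x -> S2 R y -> dot x y = 1 -> x = y.
Proof.
rewrite !S2E => hx hy hxy; apply/eqP; rewrite -subr_eq0; apply/eqP.
apply: dot_eq0; move: hx hy hxy; rewrite /dot !c3E => hx hy hxy; lra.
Qed.

(** For a unit vector [y] and [c] between 0 and 1, the closed spherical cap of angular radius
    [acos c]; [c > 0] puts it in the open hemisphere around [y]. *)
Definition cap (y : P3) (c : R) : set P3 := S2 R `&` [set x | c <= dot x y].

Lemma cap_compact y c : compact (cap y c).
Proof.
apply: (subclosed_compact _ S2_compact); last by move=> ? [].
apply: closedI; first by apply: compact_closed; [exact: norm_hausdorff|exact: S2_compact].
apply: (@closed_comp _ _ (fun x : P3 => dot x y) [set t | c <= t]); last exact: closed_ge.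
by move=> x _; exact: dot_continuous.
Qed.

(** The product with [y] is at least [c] along the chord, and points of the chord have norm at most
    1, so normalising can only increase this product. *)
Lemma cap_rad (y : P3) (c : R) x (t : R) : S2 R y -> 0 < c -> cap y c x ->
  0 <= t <= 1 -> (1 - t) *: x + t *: y <> 0 /\ cap y c (rad y x t).
Proof.
move=> Sy c0 [Sx /= cx] /andP[t0 t1].
have a1 := dot_le1 x y Sx Sy.
set w := _ + _.
have wy : dot w y = (1 - t) * dot x y + t.
  by rewrite dotDl !dotZl; move: Sy; rewrite S2E => ->; ring.
have wy0 : c <= dot w y by rewrite wy; nra.
have w0 : w <> 0 by move=> w0; move: wy0; rewrite w0 /dot !c3E; lra.
split => //; split; first exact: nrm_S2.
rewrite /= dotZl -/w.
have ww : dot w w <= 1.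
  have -> : dot w w = (1 - t) ^+ 2 * dot x x + 2 * t * (1 - t) * dot x y + t ^+ 2 * dot y y.
    by rewrite /w /dot !c3E; ring.
  have : 0 <= t * (1 - t) * (1 - dot x y) by rewrite !mulr_ge0 ?subr_ge0.
  by move: Sx Sy; rewrite !S2E => -> ->; lra.
have s0 : 0 < Num.sqrt (dot w w) by rewrite sqrtr_gt0; exact: dot_gt0.
have s1 : Num.sqrt (dot w w) <= 1 by rewrite -sqrtr1 ler_sqrt.
rewrite mulrC ler_pdivlMr //; nra.
Qed.

(** If the track meets [y] before time 1, then [x] is a multiple of [y], and the cap excludes [-y].
    So the track of another point avoids [y], the only point of [post f] that an isolating cap may
    contain. *)
Lemma rad_eq_centre (y : P3) (c : R) x (t : R) : S2 R y -> 0 < c -> cap y c x ->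
  0 <= t < 1 -> rad y x t = y -> x = y.
Proof.
move=> Sy c0 cx /andP[t0 t1] e.
have [|w0 _] := cap_rad y c x t Sy c0 cx; first by apply/andP; split; lra.
have [a a0] := nrm_scale _ w0; rewrite -/(rad y x t) e => ey.
have ex : (a * (1 - t)) *: x = (1 - a * t) *: y.
  have h i : c3 y i = a * ((1 - t) * c3 x i + t * c3 y i) by rewrite {1}ey !c3E.
  by apply: c3_inj; rewrite !c3Z; [have := h 0%N|have := h 1%N|have := h 2%N]; lra.
case: cx => Sx /= cx; apply: dot_eq1 => //.
have hx := Sx; have hy := Sy; move: hx hy; rewrite !S2E => hx hy.
have h1 : a * (1 - t) * dot x y = 1 - a * t by rewrite -dotZl ex dotZl hy mulr1.
have h2 : a * (1 - t) = (1 - a * t) * dot x y.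
  by have := dotZl (a * (1 - t)) x x; rewrite ex hx mulr1 dotZl [dot y x]dotC.
have h3 : a * (1 - t) * ((dot x y) ^+ 2 - 1) = 0.
  by rewrite mulrBr mulr1 {2}h2 expr2 mulrA h1; ring.
move/eqP: h3; rewrite !mulf_eq0 (gt_eqF a0) /= subr_eq0 (gt_eqF t1) /=.
by rewrite subr_eq0 sqrf_eq1 => /orP[/eqP//|/eqP]; lra.
Qed.

Lemma cap_isolating (P : set P3) (y : P3) : finite_set P -> P `<=` S2 R ->
  S2 R y -> exists2 c : R, 0 < c < 1 & P `&` cap y c `<=` [set y].
Proof.
move=> /finite_seqP[s ->] sS Sy.
have {sS} : forall p, p \in s -> S2 R p by [].
elim: s => [|p s IH] sS; first by exists (1 / 2) => [|x []//]; lra.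
have [q qs|c /andP[c0 c1] Hc] := IH; first by apply: sS; rewrite inE qs orbT.
have Sp : S2 R p by apply: sS; rewrite mem_head.
have [->|/eqP py] := eqVneq p y.
  exists c; first by rewrite c0.
  by move=> x [] /=; rewrite inE => /orP[/eqP//|xs] cx; apply: Hc.
have p1 : dot p y < 1.
  by rewrite lt_neqAle dot_le1 // andbT; apply/eqP => h; apply: py; exact: dot_eq1.
pose c' := Num.max c ((1 + dot p y) / 2).
have cc' : c <= c' by rewrite le_max lexx.
have pc' : (1 + dot p y) / 2 <= c' by rewrite le_max lexx orbT.
exists c'; first by rewrite lt_max c0 /= gt_max c1 /=; lra.
move=> x [] /=; rewrite inE => /orP[/eqP->|xs] [Sx /= cx]; first by exfalso; lra.
by apply: Hc; split => //; split => //=; lra.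
Qed.

Lemma cap_nbhs (y : P3) (c : R) : S2 R y -> c < 1 -> exists2 d : R, 0 < d &
  forall x, S2 R x -> `|x - y| < d -> cap y c x.
Proof.
move=> Sy c1.
have cd : cts_on (setT : set P3) (fun x => dot x y).
  by apply: cts_onW => x _; exact: dot_continuous.
have [||d d0 Hd] := cd y _ (1 - c); rewrite ?subr_gt0 //.
exists d => // x Sx xy; split => //=; have := Hd x I xy.
by move: (Sy); rewrite S2E => ->; rewrite ltr_norml; lra.
Qed.

End Sphere.

(** * Planar power maps and the local forms of a branched covering *)

Section Polar.
Context {R : realType}.
Local Notation P2 := 'rV[R]_2.
Local Notation P3 := 'rV[R]_3.

Lemma c2D (x y : P2) i : c2 (x + y) i = c2 x i + c2 y i.
Proof. by rewrite /c2 mxE. Qed.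

Lemma c2Z (a : R) (x : P2) i : c2 (a *: x) i = a * c2 x i.
Proof. by rewrite /c2 mxE. Qed.

Lemma c2_0 i : c2 (0 : P2) i = 0.
Proof. by rewrite /c2 mxE. Qed.

Lemma c2_mk2 (a b : R) : (c2 (mk2 a b) 0 = a) * (c2 (mk2 a b) 1 = b).
Proof. by rewrite /c2 /mk2 !mxE /= !inordK. Qed.

Lemma c2_inj (x y : P2) : c2 x 0 = c2 y 0 -> c2 x 1 = c2 y 1 -> x = y.
Proof.
move=> h0 h1; apply/rowP => i; rewrite -(inord_val i).
by case: i => -[|[|//]] ?.
Qed.

Local Notation c2E := (c2D, c2Z, c2_0, c2_mk2).

Lemma mk2E (a b : R) : mk2 a b = a *: mk2 1 0 + b *: mk2 0 1.
Proof. by apply: c2_inj; rewrite !c2E; lra. Qed.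

Lemma c2_continuous i : continuous (fun x : P2 => c2 x i).
Proof. exact: coord_continuous. Qed.

Definition cis (th : R) : P2 := mk2 (cos th) (sin th).

Lemma cis_continuous : continuous cis.
Proof.
have -> : cis = fun th => cos th *: mk2 1 0 + sin th *: mk2 0 1.
  by apply/funext => th; exact: mk2E.
move=> th; exact: (cvgD (cvgZ (@continuous_cos R th) (cvg_cst _))
  (cvgZ (@continuous_sin R th) (cvg_cst _))).
Qed.

Lemma cis_S1 th : S1 R (cis th).
Proof. by rewrite /S1 /= /sq2 !c2E cos2Dsin2. Qed.

Lemma sq2_polar (a th : R) : sq2 (a *: cis th) = a ^+ 2.
Proof.
rewrite /sq2 !c2E; have := cos2Dsin2 th => h.
by rewrite !exprMn -mulrDr h mulr1.
Qed.

Lemma polar_form (z : P2) : exists a th : R,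
  [/\ 0 <= a, a ^+ 2 = sq2 z & z = a *: cis th].
Proof.
have sz : 0 <= sq2 z by rewrite /sq2 addr_ge0 // sqr_ge0.
pose a := Num.sqrt (sq2 z); have a0 : 0 <= a by exact: sqrtr_ge0.
have a2 : a ^+ 2 = sq2 z by rewrite sqr_sqrtr.
exists a; have [az|az] := eqVneq a 0.
  exists 0; split => //; rewrite az scale0r.
  move: a2; rewrite az /sq2 expr0n /= => h.
  have := sqr_ge0 (c2 z 0); have := sqr_ge0 (c2 z 1) => h1 h0.
  by apply: c2_inj; rewrite c2_0; apply/eqP; rewrite -sqrf_eq0; apply/eqP; lra.
have agt0 : 0 < a by rewrite lt0r az.
pose u := c2 z 0 / a.
have ua : c2 z 0 = a * u by rewrite /u mulrC divfK.
pose v := c2 z 1 / a.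
have va : c2 z 1 = a * v by rewrite /v mulrC divfK.
have uv : u ^+ 2 + v ^+ 2 = 1.
  apply: (mulfI (lt0r_neq0 (exprn_gt0 2 agt0))); rewrite mulr1 {2}a2 /sq2 ua va; ring.
have u1 : -1 <= u <= 1 by apply/andP; split; nra.
have su : Num.sqrt (1 - u ^+ 2) = `|v|.
  by rewrite (_ : 1 - u ^+ 2 = v ^+ 2) ?sqrtr_sqr //; lra.
have [v0|v0] := leP 0 v.
  exists (acos u); split => //; apply: c2_inj; rewrite !c2E.
    by rewrite acosK // in_itv /=.
  by rewrite sin_acos // su ger0_norm.
exists (- acos u); split => //; apply: c2_inj; rewrite !c2E.
  by rewrite cosN acosK // in_itv /=.
by rewrite sinN sin_acos // su ltr0_norm // opprK.
Qed.

Lemma S1_polar (z : P2) : S1 R z -> exists th, z = cis th.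
Proof.
have [a [th [a0 a2 ->]]] := polar_form z.
rewrite /S1 /= sq2_polar => /eqP; rewrite sqrf_eq1 => /orP[|] /eqP ->.
  by exists th; rewrite scale1r.
exists (th + pi); apply: c2_inj; rewrite !c2E ?cosDpi ?sinDpi; lra.
Qed.

Lemma cpow_polar (a th : R) n :
  cpow (a *: cis th) n = a ^+ n *: cis (n%:R * th).
Proof.
elim: n => [|n IH].
  by rewrite /cpow /= expr0 scale1r mul0r /cis cos0 sin0.
rewrite /cpow iterS -/(cpow _ n) IH /cmul -natr1 mulrDl mul1r [n%:R * th + th]addrC.
by apply: c2_inj; rewrite !c2E ?cosD ?sinD exprS; ring.
Qed.

Lemma cpow_cis th n : cpow (cis th) n = cis (n%:R * th).
Proof. by have := cpow_polar 1 th n; rewrite expr1n !scale1r. Qed.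

Lemma cpow1 (z : P2) : cpow z 1 = z.
Proof. by rewrite /cpow /= /cmul; apply: c2_inj; rewrite !c2E; ring. Qed.

Lemma cpow_eq0 (z : P2) n : (0 < n)%N -> cpow z n = 0 -> z = 0.
Proof.
move=> n0; have [a [th [a0 a2 ->]]] := polar_form z.
rewrite cpow_polar => h; have := sq2_polar (a ^+ n) (n%:R * th).
rewrite h /sq2 !c2E !expr0n /= addr0 => /esym/eqP.
by rewrite !expf_eq0 /= n0 /= => /eqP ->; rewrite scale0r.
Qed.

Lemma cpow_root (z : P2) n (e : R) : (0 < n)%N -> 0 < e ->
  sq2 z < (e ^+ n) ^+ 2 -> exists2 w, sq2 w < e ^+ 2 & cpow w n = z.
Proof.
move=> n0 e0; have [a [th [a0 a2 ->]]] := polar_form z; rewrite sq2_polar => ae.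
pose b := a `^ (n%:R^-1).
have b0 : 0 <= b by exact: powR_ge0.
have n0' : n%:R != 0 :> R by rewrite pnatr_eq0 -lt0n.
have bn : b ^+ n = a by rewrite -powR_mulrn // -powRrM mulVf // powRr1.
exists (b *: cis (n%:R^-1 * th)); last first.
  by rewrite cpow_polar bn mulrA mulfV // mul1r.
rewrite sq2_polar; move: ae.
have en : 0 <= e ^+ n by rewrite exprn_ge0 // ltW.
rewrite ltr_pXn2r ?nnegrE // -bn => h.
rewrite ltr_pXn2r ?nnegrE //; last exact: ltW.
by move: h; rewrite ltr_pXn2r ?nnegrE //; exact: ltW.
Qed.

Lemma Disk0 : Disk R 0.
Proof. by rewrite /Disk /= /sq2 !c2E expr0n /= addr0 ltr01. Qed.

Lemma sq2_cts : cts_on (setT : set P2) (@sq2 R).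
Proof.
have M i : continuous (fun x : P2 => c2 x i ^+ 2).
  by move=> x; exact: (cvgM (c2_continuous i x) (c2_continuous i x)).
by apply: cts_onW => x _; exact: (cvgD (M 0%N x) (M 1%N x)).
Qed.

Lemma norm_lt_sq2 (e : R) : 0 < e -> exists2 d : R, 0 < d &
  forall z : P2, sq2 z < d ^+ 2 -> `|z| < e.
Proof.
(* [M] bounds the norm of every [cis th], by the triangle inequality in the two basis vectors. *)
move=> e0; pose M := `|mk2 1 0 : P2| + `|mk2 0 1 : P2| + 1.
have M0 : 0 < M.
  by have := normr_ge0 (mk2 1 0 : P2); have := normr_ge0 (mk2 0 1 : P2); rewrite /M; lra.
exists (e / M); first exact: divr_gt0.
move=> z; have [a [th [a0 <- ->]]] := polar_form z.
rewrite ltr_pXn2r ?nnegrE //; last by apply/ltW/divr_gt0.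
rewrite ltr_pdivlMr // => aM; apply: le_lt_trans aM.
rewrite normrZ ger0_norm // ler_wpM2l // /cis mk2E.
apply: (le_trans (ler_normD _ _)); rewrite !normrZ /M.
have c1 : `|cos th| <= 1 by exact: cos_max.
have s1 : `|sin th| <= 1 by exact: sin_max.
have := normr_ge0 (mk2 1 0 : P2); have := normr_ge0 (mk2 0 1 : P2).
by nra.
Qed.

Section LocalForm.
Context (f : P3 -> P3) (p : P3) (q : nat).

Lemma rel_open_nbhs (U : set P3) x : rel_open U -> U x -> exists2 r : R, 0 < r &
  forall z, S2 R z -> `|z - x| < r -> U z.
Proof.
move=> [US [W [oO UO]]] Ux.
have : nbhs x W by apply: open_nbhs_nbhs; split => //; move: Ux; rewrite UO => -[].
move=> /nbhs_ballP[r /= r0 Hr]; exists r => // z Sz zx.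
by rewrite UO; split => //; apply: Hr; rewrite -ball_normE /= distrC.
Qed.

Lemma local_form_disc : (0 < q)%N -> local_form f p q -> exists2 r : R, 0 < r &
  forall z, S2 R z -> `|z - p| < r -> f z = f p -> z = p.
Proof.
move=> q0 [U [V [phi [phii [psi [psii]]]]]].
move=> [[Up Vp] [oU [m1 m2 i1 i2 _] _] _ [phip psip] H].
have [r r0 Hr] := rel_open_nbhs U p oU Up; exists r => // z Sz zp fz.
have Uz := Hr z Sz zp.
have [_] := H (phi z) (m1 z Uz); rewrite i1 // fz psip => /esym/(cpow_eq0 _ _ q0).
by rewrite -phip => e; rewrite -(i1 z Uz) e i1.
Qed.

Lemma local_form_open : (0 < q)%N -> local_form f p q -> forall r : R, 0 < r ->
  exists2 d : R, 0 < d & forall w, S2 R w -> `|w - f p| < d ->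
    exists z, [/\ S2 R z, `|z - p| < r & f z = w].
Proof.
move=> q0 [U [V [phi [phii [psi [psii]]]]]].
move=> [[Up Vp] [oU [m1 m2 i1 i2 [_ cphii]] _] [oV [n1 n2 j1 j2 [cpsi _]] _] [phip psip] H] r r0.
have phii0 : phii 0 = p by rewrite -phip i1.
move/cts_onP: cphii => /(_ 0 Disk0 r r0)[e e0 He].
have [e1 e10 He1] := norm_lt_sq2 e e0.
(* The bound 1 keeps the [q]-th root inside [Disk]; the bound [e1] brings its image within [r] of
   [p]. *)
pose e2 := Num.min e1 1.
have e20 : 0 < e2 by rewrite lt_min e10 ltr01.
have e21 : e2 <= e1 by rewrite ge_min lexx.
have e22 : e2 <= 1 by rewrite ge_min lexx orbT.
have [||d1 d10 Hd1] := sq2_cts 0 _ ((e2 ^+ q) ^+ 2); rewrite ?exprn_gt0 //.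
move/cts_onP: cpsi => /(_ (f p) Vp d1 d10)[d2 d20 Hd2].
have [d3 d30 Hd3] := rel_open_nbhs V (f p) oV Vp.
exists (Num.min d2 d3); first by rewrite lt_min d20.
move=> w Sw; rewrite lt_min => /andP[wd2 wd3].
have Vw := Hd3 w Sw wd3.
have := Hd2 w Vw wd2; rewrite psip => /(Hd1 _ I).
rewrite {2}/sq2 !c2E !expr0n /= addr0 subr0 ltr_norml => /andP[_].
move=> /(cpow_root _ _ _ q0 e20)[u ue uq].
have Du : Disk R u by rewrite /Disk /=; nra.
have [Vu pu] := H u Du.
exists (phii u); split.
- by apply: (proj1 oU); exact: m2.
- rewrite -phii0; apply: He => //; rewrite subr0; apply: He1.
  by apply: lt_le_trans ue _; rewrite ler_pXn2r ?nnegrE // ltW.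
- by rewrite -(j1 _ Vu) pu uq j1.
Qed.

Lemma local_form1_inj : local_form f p 1 -> exists2 r : R, 0 < r &
  forall z z', S2 R z -> S2 R z' -> `|z - p| < r -> `|z' - p| < r ->
    f z = f z' -> z = z'.
Proof.
move=> [U [V [phi [phii [psi [psii]]]]]].
move=> [[Up Vp] [oU [m1 m2 i1 i2 _] _] _ [phip psip] H].
have [r r0 Hr] := rel_open_nbhs U p oU Up; exists r => // z z' Sz Sz' zp zp' fz.
have Uz := Hr z Sz zp; have Uz' := Hr z' Sz' zp'.
have [_] := H (phi z) (m1 z Uz); have [_] := H (phi z') (m1 z' Uz').
rewrite !cpow1 i1 // i1 // fz => -> e.
by rewrite -(i1 z Uz) -e i1.
Qed.

(** The disc points of radius 1/2 at angles 0 and [2 pi / q] have the same [q]-th power, and they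
    differ because [0 < 2 pi / q <= pi]. *)
Lemma local_form_noninj : (1 < q)%N -> local_form f p q ->
  exists z z', [/\ S2 R z, S2 R z', z <> z' & f z = f z'].
Proof.
move=> q1 [U [V [phi [phii [psi [psii]]]]]].
move=> [[Up Vp] [oU [m1 m2 i1 i2 _] _] [oV [n1 n2 j1 j2 _] _] [phip psip] H].
have q0 : (0 : R) < q%:R by rewrite ltr0n ltnW.
pose w (t : R) := 2^-1 *: cis t.
have Dw t : Disk R (w t) by rewrite /Disk /= sq2_polar; lra.
have qw : cpow (w (2 * pi / q%:R)) q = cpow (w 0) q.
  rewrite !cpow_polar mulr0 [q%:R * _]mulrC divfK ?lt0r_neq0 //; congr (_ *: _).
  by rewrite /cis mulr_natl cos2pi sin2pi cos0 sin0.
exists (phii (w (2 * pi / q%:R))), (phii (w 0)); split.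
- by apply: (proj1 oU); exact: m2.
- by apply: (proj1 oU); exact: m2.
- move=> e; have : w (2 * pi / q%:R) = w 0 by rewrite -(i2 _ (Dw _)) e i2.
  move=> /(congr1 (fun z => c2 z 0)); rewrite !c2E cos0.
  move=> h; have {}h : cos (2 * pi / q%:R) = 1 :> R by lra.
  have pi0 := pi_gt0 R.
  have x0 : 0 < 2 * pi / q%:R :> R by rewrite divr_gt0 // mulr_gt0.
  have x1 : 2 * pi / q%:R <= pi :> R.
    rewrite ler_pdivrMr // mulrC ler_pM2l //.
    by rewrite ler_nat.
  have : acos (cos (2 * pi / q%:R)) = 2 * pi / q%:R :> R.
    by apply: cosK; rewrite in_itv /= x1 andbT ltW.
  by rewrite h acos1; lra.
- have [V1 e1] := H _ (Dw (2 * pi / q%:R)); have [V2 e2] := H _ (Dw 0).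
  by rewrite -(j1 _ V1) e1 qw -e2 j1.
Qed.

End LocalForm.

Lemma S2_iter (f : P3 -> P3) n x : (forall x, S2 R x -> S2 R (f x)) ->
  S2 R x -> S2 R (iter n f x).
Proof. by move=> Sf Sx; elim: n => //= n; exact: Sf. Qed.

Lemma post_S2 (f : P3 -> P3) : branched_cover f -> post f `<=` S2 R.
Proof. by move=> [Sf _ _] y [c [n [[Sc _] [_ ->]]]]; exact: S2_iter. Qed.

(** One set serves all iterates because [post f] is forward invariant and contains the critical
    values of [f]: if the end of an orbit is outside it, every step has local degree 1. *)
Lemma branched_map_iter (f : P3 -> P3) m : branched_cover f ->
  branched_map (S2 R) (post f) (iter m f).
Proof.
move=> [Sf /cts_onP cf lf]; elim: m => [|m [IH1 IH2 IH3 IH4 IH5]].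
  split=> //=.
  - by move=> x _ e e0; exists e.
  - by move=> b Sb r r0; exists r => // w Sw wb; exists w.
  - by move=> b Sb; exists 1.
  - by move=> b Sb; exists 1.
split=> /=.
- by move=> x Sx; apply: Sf; exact: IH1.
- exact: (cts_on_comp _ (S2 R) (iter m f) f).
- move=> b Sb r r0; have [d d0 Hd] := IH3 b Sb r r0.
  have Sg := IH1 b Sb; have [q [q0 lq]] := lf _ Sg.
  have [e e0 He] := local_form_open f _ q q0 lq d d0.
  exists e => // w Sw /(He w Sw)[u [Su ud fu]].
  by have [z [Sz zb gz]] := Hd u Su ud; exists z; rewrite gz.
- move=> b Sb; have [d d0 Hd] := IH4 b Sb.
  have Sg := IH1 b Sb; have [q [q0 lq]] := lf _ Sg.
  have [e e0 He] := local_form_disc f _ q q0 lq.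
  have [d' d'0 Hd'] := IH2 b Sb e e0.
  exists (Num.min d d'); first by rewrite lt_min d0.
  move=> z Sz; rewrite lt_min => /andP[zd zd'] fz; apply: Hd => //.
  by apply: He => //; [exact: IH1|exact: Hd'].
- move=> b Sb nP.
  have Sg := IH1 b Sb; have [q [q0 lq]] := lf _ Sg.
  have [|d d0 Hd] := IH5 b Sb.
    by move=> [c [n [cc [n0 e]]]]; apply: nP; exists c, n.+1; rewrite /= -e.
  have q1 : q = 1%N.
    case: q q0 lq => [//|[//|q]] _ lq; case: nP; exists (iter m f b), 1%N.
    by split => //; split => //; exists q.+2.
  move: lq; rewrite q1 => /local_form1_inj[e e0 He].
  have [d' d'0 Hd'] := IH2 b Sb e e0.
  exists (Num.min d d'); first by rewrite lt_min d0.
  move=> z z' Sz Sz'; rewrite !lt_min => /andP[zd zd'] /andP[z'd z'd'] fz.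
  by apply: Hd => //; apply: He => //; solve [exact: IH1|exact: Hd'].
Qed.

End Polar.

(** * A Jordan curve through the postcritical set as a graph over a great circle *)

Section Curve.
Context {R : realType}.
Local Notation P2 := 'rV[R]_2.
Local Notation P3 := 'rV[R]_3.
Local Notation c3E := (c3D, c3Z, c3N, c3_0, c3_mk3).

Lemma exists_nonroot (s : seq {poly R}) :
  exists t : R, forall q, q \in s -> q = 0 \/ q.[t] != 0.
Proof.
pose q := \prod_(r <- s | r != 0) r.
have q0 : q != 0 by rewrite /q prodf_seq_neq0; apply/allP => r _; exact/implyP.
have [t qt] : exists t, ~~ root q t.
  apply: contrapT => /forallNP H.
  have := @max_poly_roots R q [seq n%:R | n <- iota 0 (size q)] q0.
  rewrite size_map size_iota ltnn => h.
  suff : false by []; apply: h.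
    by apply/allP => x _; apply/negPn/negP; exact: H.
  by rewrite map_inj_uniq ?iota_uniq // => m n /eqP; rewrite eqr_nat => /eqP.
exists t => r rs; have [r0|r0] := eqVneq r 0; [by left|right].
move: qt; rewrite /root /q horner_prod; apply: contra => rt.
by rewrite (big_rem r rs) /= r0 (eqP rt) mul0r.
Qed.

Section Projection.
Variable t : R.

(** A point of the moment curve: a plane through the origin contains at most two of them, so
    finitely many planes can be avoided by the choice of [t]. *)
Definition axis : P3 := mk3 1 t (t ^+ 2).
Definition prj (x : P3) : P3 := x - c3 x 0 *: axis.

Lemma prj_c3 x : (c3 (prj x) 0 = 0) * (c3 (prj x) 1 = c3 x 1 - t * c3 x 0) *
  (c3 (prj x) 2 = c3 x 2 - t ^+ 2 * c3 x 0).
Proof. by rewrite /prj /axis !c3E; do !split; ring. Qed.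

Lemma prjZ a x : prj (a *: x) = a *: prj x.
Proof. by rewrite /prj c3Z scalerBr scalerA. Qed.

Lemma prj_axis x s : prj (x + s *: axis) = prj x.
Proof. by apply: c3_inj; rewrite !prj_c3 /axis ?c3E //; ring. Qed.

Lemma prj_continuous : continuous prj.
Proof.
move=> x; exact: (cvgB cvg_id (cvgZ (c3_continuous 0 x) (cvg_cst axis))).
Qed.

(* Functions of the direction [prj x], homogeneous of degree one: their graphs
   over the plane transverse to [axis] are cones over curves in the sphere. *)
Definition cone_fun (Q : P3 -> R) := [/\ continuous Q,
  (forall a x, 0 <= a -> Q (a *: x) = a * Q x) &
  (forall x s, Q (x + s *: axis) = Q x)].

Definition elen (x : P3) : R := Num.sqrt (dot (prj x) (prj x)).

Lemma elen_cone : cone_fun elen.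
Proof.
split.
- move=> x; apply: (@continuous_comp _ _ _ (fun x : P3 => dot (prj x) (prj x)) Num.sqrt).
    apply: (@continuous_comp _ _ _ prj (fun x : P3 => dot x x)).
      exact: prj_continuous.
    exact: dot_self_continuous.
  exact: sqrt_continuous.
- move=> a x a0; rewrite /elen prjZ dotZl dotZr mulrA -expr2 sqrtrM ?sqr_ge0 //.
  by rewrite sqrtr_sqr ger0_norm.
- by move=> x s; rewrite /elen prj_axis.
Qed.

(* Vanishes exactly on the half-plane bounded by the axis through [p]. *)
Definition angle_defect (p x : P3) : R :=
  elen p * elen x - dot (prj x) (prj p).

Lemma angle_defect_cone p : cone_fun (angle_defect p).
Proof.
have [c h a] := elen_cone; split.
- move=> x.
  have c2 : {for x, continuous (fun x : P3 => dot (prj x) (prj p))}.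
    apply: (@continuous_comp _ _ _ prj (fun x : P3 => dot x (prj p))).
      exact: prj_continuous.
    exact: dot_continuous.
  exact: (cvgB (cvgM (cvg_cst _) (c x)) c2).
- by move=> b x b0; rewrite /angle_defect h // prjZ dotZl; ring.
- by move=> x s; rewrite /angle_defect a prj_axis.
Qed.

Lemma angle_defectpp p : angle_defect p p = 0.
Proof. by rewrite /angle_defect /elen -expr2 sqr_sqrtr ?dot_ge0 // subrr. Qed.

(** The geometric mean vanishes where either factor does, as the product would, but keeps
    homogeneity of degree one. *)
Lemma cone_fun_gmean Q Q' : cone_fun Q -> cone_fun Q' ->
  cone_fun (fun x => Num.sqrt (Q x * Q' x)).
Proof.
move=> [c h a] [c' h' a']; split.
- move=> x; apply: (@continuous_comp _ _ _ (fun x : P3 => Q x * Q' x) Num.sqrt).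
    exact: (cvgM (c x) (c' x)).
  exact: sqrt_continuous.
- move=> b x b0; rewrite h // h' // mulrACA -expr2 sqrtrM ?sqr_ge0 //.
  by rewrite sqrtr_sqr ger0_norm.
- by move=> x s; rewrite a a'.
Qed.

Lemma cone_fun_lin Q Q' k : cone_fun Q -> cone_fun Q' ->
  cone_fun (fun x => Q x + k * Q' x).
Proof.
move=> [c h a] [c' h' a']; split.
- by move=> x; exact: (cvgD (c x) (cvgM (cvg_cst k) (c' x))).
- by move=> b x b0; rewrite h // h' //; ring.
- by move=> x s; rewrite a a'.
Qed.

Lemma cone_separator (s : seq P3) p : prj p <> 0 ->
  (forall r, r \in s -> 0 < angle_defect r p) ->
  exists Q, [/\ cone_fun Q, 0 < Q p & forall r, r \in s -> Q r = 0].
Proof.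
move=> p0; elim: s => [|r s IH] H.
  exists elen; split=> //; first exact: elen_cone.
  by rewrite sqrtr_gt0; exact: dot_gt0.
have [r' r's|Q [cQ Qp Qs]] := IH; first by apply: H; rewrite inE r's orbT.
exists (fun x => Num.sqrt (angle_defect r x * Q x)); split.
- by apply: cone_fun_gmean => //; exact: angle_defect_cone.
- by rewrite sqrtr_gt0 mulr_gt0 // H // mem_head.
- move=> r'; rewrite inE => /orP[/eqP ->|r's].
    by rewrite angle_defectpp mul0r sqrtr0.
  by rewrite Qs // mulr0 sqrtr0.
Qed.

(** Newton interpolation with separators as basis functions: the correction for a new point vanishes
    at the earlier ones. *)
Lemma cone_interpolation (h : P3 -> R) (s : seq P3) :
  (forall p, p \in s -> prj p <> 0) ->
  (forall p r, p \in s -> r \in s -> p <> r -> 0 < angle_defect r p) ->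
  exists2 Q, cone_fun Q & forall p, p \in s -> Q p = h p.
Proof.
elim: s => [|p s IH] H0 H.
  exists (fun=> 0) => //; split=> //; last by move=> a x _; rewrite mulr0.
  exact: cst_continuous.
have [ps|ps] := boolP (p \in s).
  have [q qs|q r qs rs|Q cQ Qs] := IH.
  - by apply: H0; rewrite inE qs orbT.
  - by apply: H; rewrite inE ?qs ?rs orbT.
  - by exists Q => // q; rewrite inE => /orP[/eqP ->|qs]; apply: Qs.
have [q qs|q r qs rs|Q cQ Qs] := IH.
- by apply: H0; rewrite inE qs orbT.
- by apply: H; rewrite inE ?qs ?rs orbT.
have [|r rs|D [cD Dp Ds]] := cone_separator s p.
- by apply: H0; rewrite mem_head.
- apply: H; rewrite ?mem_head // ?inE ?rs ?orbT //.
  by move=> pr; move: ps; rewrite pr rs.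
exists (fun x => Q x + (h p - Q p) / D p * D x); first exact: cone_fun_lin.
move=> r; rewrite inE => /orP[/eqP ->|rs].
  by rewrite divfK ?lt0r_neq0 // addrC subrK.
by rewrite (Ds r rs) mulr0 addr0 Qs.
Qed.

(** The cone is a graph over the plane transverse to the axis, and by homogeneity each of its rays
    meets the graph over the unit circle exactly once. Normalising that graph parametrises the
    curve. *)
Lemma cone_jordan_curve (Q : P3 -> R) : cone_fun Q ->
  jordan_curve (S2 R `&` [set x | c3 x 0 = Q x]).
Proof.
move=> [cQ hQ aQ]; split; first by move=> x [].
pose w (z : P2) := mk3 0 (c2 z 0) (c2 z 1).
have wE z : w z = c2 z 0 *: mk3 0 1 0 + c2 z 1 *: mk3 0 0 1.
  by rewrite /w mk3E scale0r add0r.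
pose u z := w z + Q (w z) *: axis.
have uc z : (c3 (u z) 0 = Q (w z)) * (c3 (u z) 1 = c2 z 0 + Q (w z) * t) *
   (c3 (u z) 2 = c2 z 1 + Q (w z) * t ^+ 2).
  by rewrite /u /w /axis !c3E; do !split; ring.
have u0 z : S1 R z -> u z <> 0.
  rewrite /S1 /= /sq2 => Sz e; have := uc z; rewrite e !c3_0 => -[[]] <-.
  rewrite !mul0r !addr0 => h0 h1; move: Sz; rewrite -h0 -h1 expr0n /= addr0.
  by move=> /eqP; rewrite eq_sym oner_eq0.
have cw : continuous w.
  have -> : w = fun z => c2 z 0 *: mk3 0 1 0 + c2 z 1 *: mk3 0 0 1 by apply/funext.
  move=> z; exact: (cvgD (cvgZ (c2_continuous 0 z) (cvg_cst _))
    (cvgZ (c2_continuous 1 z) (cvg_cst _))).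
have cu : continuous u.
  move=> z; have cQw : {for z, continuous (Q \o w)}.
    by apply: continuous_comp; [exact: cw|exact: cQ].
  exact: (cvgD (cw z) (cvgZ cQw (cvg_cst axis))).
exists (nrm \o u); split.
- apply/cts_onP/cts_onW => z Sz; apply: continuous_comp; first exact: cu.
  by apply: nrm_continuous; exact: u0.
- move=> z z' Sz Sz' /=.
  have [a a0 ->] := nrm_scale _ (u0 z Sz); have [a' a'0 ->] := nrm_scale _ (u0 z' Sz').
  move=> e.
  have e0 := congr1 (fun x => c3 x 0) e; have e1 := congr1 (fun x => c3 x 1) e.
  have e2 := congr1 (fun x => c3 x 2) e.
  move: e0 e1 e2; rewrite /= !c3Z !uc => e0 e1 e2.
  have e0t (k : R) : k * (a * Q (w z)) = k * (a' * Q (w z')) by rewrite e0.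
  have h0 : a * c2 z 0 = a' * c2 z' 0 by have := e0t t; lra.
  have h1 : a * c2 z 1 = a' * c2 z' 1 by have := e0t (t ^+ 2); lra.
  have aa : a ^+ 2 = a' ^+ 2.
    move: Sz Sz'; rewrite /S1 /= /sq2 => Sz Sz'.
    rewrite -[LHS]mulr1 -[RHS]mulr1 -{1}Sz -Sz' !mulrDr -!exprMn h0 h1 //.
  have {}aa : a = a'.
    by apply/eqP; rewrite -(@eqrXn2 _ 2) ?ltW //; apply/eqP.
  move: h0 h1; rewrite -aa => h0 h1.
  by apply: c2_inj; apply: (mulfI (lt0r_neq0 a0)).
- apply/seteqP; split=> [_ [z Sz <-]|x [Sx /= Gx]].
    split; first by apply: nrm_S2; exact: u0.
    rewrite /=; have [a a0 ->] := nrm_scale _ (u0 z Sz).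
    by rewrite hQ ?ltW // c3Z uc /u aQ.
  pose b := mk2 (c3 (prj x) 1) (c3 (prj x) 2).
  have wb : w b = prj x.
    by apply: c3_inj; rewrite /w /b !c3_mk3 ?c2_mk2 ?prj_c3.
  have xE : x = prj x + c3 x 0 *: axis by rewrite /prj subrK.
  have Qx : c3 x 0 = Q (w b) by rewrite wb Gx {1}xE aQ.
  have [a [th [a0 _ bE]]] := polar_form b.
  have wa : w b = a *: w (cis th).
    by rewrite bE; apply: c3_inj; rewrite /w !c3E ?c2Z ?mulr0.
  have xu : x = a *: u (cis th).
    rewrite {1}xE Qx -wb wa hQ // /u scalerDr scalerA //.
  have a0' : 0 < a.
    rewrite lt0r a0 andbT; apply/eqP => a0'.
    by apply: (S2_neq0 _ Sx); rewrite xu a0' scale0r.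
  exists (cis th); first exact: cis_S1.
  by rewrite /= -(nrmZ a) // -xu nrm_id.
Qed.

End Projection.

(** Lagrange's identity: the squares of [dot p r] and of the three minors add up to 1, so [dot p r]
    is 1 or -1. *)
Lemma S2_minors (p r : P3) : S2 R p -> S2 R r ->
  c3 p 1 * c3 r 2 - c3 p 2 * c3 r 1 = 0 ->
  c3 p 0 * c3 r 2 - c3 p 2 * c3 r 0 = 0 ->
  c3 p 0 * c3 r 1 - c3 p 1 * c3 r 0 = 0 -> p = r \/ p = - r.
Proof.
move=> Sp Sr h12 h02 h01.
have Snr : S2 R (- r) by move: Sr; rewrite !S2E /dot !c3E !mulrNN.
have hp := Sp; have hr := Sr; rewrite !S2E in hp hr.
have : dot p r ^+ 2 = 1.
  have -> : dot p r ^+ 2 = dot p p * dot r r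
    - (c3 p 1 * c3 r 2 - c3 p 2 * c3 r 1) ^+ 2
    - (c3 p 0 * c3 r 2 - c3 p 2 * c3 r 0) ^+ 2
    - (c3 p 0 * c3 r 1 - c3 p 1 * c3 r 0) ^+ 2 by rewrite /dot; ring.
  by rewrite hp hr h12 h02 h01 expr0n /=; ring.
move/eqP; rewrite sqrf_eq1 => /orP[/eqP h|/eqP h].
  by left; apply: dot_eq1.
by right; apply: dot_eq1 => //; move: h; rewrite /dot !c3E; lra.
Qed.

(** [B p r] at [t] is the determinant of [axis t], [p] and [r]. Where it is nonzero, the projections
    are independent and Cauchy-Schwarz is strict. It is the zero polynomial only for [r = p] or
    [r = -p], and antipodal points project to opposite directions. [A p] at [t] is a coordinate of
    [prj t p]; if it vanishes identically, then [p] lies in the image plane and is its own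
    projection. *)
Lemma generic_axis (s : seq P3) : (forall p, p \in s -> S2 R p) ->
  exists t : R, (forall p, p \in s -> prj t p <> 0) /\
    (forall p r, p \in s -> r \in s -> p <> r -> 0 < angle_defect t r p).
Proof.
move=> sS.
pose A (p : P3) : {poly R} := Poly [:: c3 p 1; - c3 p 0].
pose B (p r : P3) : {poly R} := Poly [:: c3 p 1 * c3 r 2 - c3 p 2 * c3 r 1;
  - (c3 p 0 * c3 r 2 - c3 p 2 * c3 r 0); c3 p 0 * c3 r 1 - c3 p 1 * c3 r 0].
have [t Ht] := exists_nonroot ([seq A p | p <- s] ++ [seq B p r | p <- s, r <- s]).
have np p : p \in s -> prj t p <> 0.
  move=> ps pr0.
  have h1 : c3 p 1 - t * c3 p 0 = 0 by rewrite -(prj_c3 t p) pr0 c3_0.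
  have h2 : c3 p 2 - t ^+ 2 * c3 p 0 = 0 by rewrite -(prj_c3 t p) pr0 c3_0.
  have [A0|] := Ht (A p) (ltac:(by rewrite mem_cat map_f)).
    have p0 : c3 p 0 = 0.
      have := congr1 (fun q : {poly R} => q`_1) A0.
      by rewrite coef_Poly coef0 /= => /eqP; rewrite oppr_eq0 => /eqP.
    apply: (S2_neq0 p (sS p ps)); apply: c3_inj; rewrite c3_0 //.
      by move: h1; rewrite p0; lra.
    by move: h2; rewrite p0; lra.
  rewrite horner_Poly /= => /eqP; apply; lra.
exists t; split=> // p r ps rs pr.
set X := dot (prj t p) (prj t r).
have lp : 0 < elen t p by rewrite sqrtr_gt0; apply: dot_gt0; exact: np.
have lr : 0 < elen t r by rewrite sqrtr_gt0; apply: dot_gt0; exact: np.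
rewrite /angle_defect subr_gt0 -/X.
have [B0|] := Ht (B p r) (ltac:(by rewrite mem_cat (allpairs_f _ ps rs) orbT)).
  have cB i := congr1 (fun q : {poly R} => q`_i) B0.
  have [//||||e] := @S2_minors p r (sS p ps) (sS r rs).
  - by have := cB 0%N; rewrite coef_Poly coef0.
  - by have := cB 1%N; rewrite coef_Poly coef0 /=; lra.
  - by have := cB 2%N; rewrite coef_Poly coef0.
  - by [].
  have -> : X = - dot (prj t r) (prj t r).
    by rewrite /X e -scaleN1r prjZ dotZl mulN1r.
  by have := dot_ge0 (prj t r); nra.
rewrite horner_Poly /= => Bn.
have key : (elen t r * elen t p) ^+ 2 - X ^+ 2 =
    (c3 (prj t p) 1 * c3 (prj t r) 2 - c3 (prj t p) 2 * c3 (prj t r) 1) ^+ 2.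
  by rewrite exprMn /elen !sqr_sqrtr ?dot_ge0 // /X /dot !prj_c3; ring.
have Y0 : 0 < (elen t r * elen t p) ^+ 2 - X ^+ 2.
  rewrite key exprn_even_gt0 //=; apply: contra Bn => /eqP e; apply/eqP.
  by move: e; rewrite !prj_c3; lra.
have := mulr_gt0 lr lp; nra.
Qed.

Lemma exists_cone_curve (P : set P3) : finite_set P -> P `<=` S2 R ->
  exists (v : P3) (G : P3 -> R), [/\ v <> 0, continuous G,
    (forall a x, 0 <= a -> G (a *: x) = a * G x),
    (forall x s, G (x + s *: v) = G x + s) &
    jordan_curve (S2 R `&` [set x | G x = 0]) /\
    P `<=` S2 R `&` [set x | G x = 0]].
Proof.
move=> /finite_seqP[s ->] sS.
have [t [t1 t2]] := generic_axis s sS.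
have [Q cQ Qs] := cone_interpolation t (fun p => c3 p 0) s t1 t2.
exists (axis t), (fun x => c3 x 0 - Q x); have [c h a] := cQ; split.
- by move=> /(congr1 (fun x => c3 x 0)); rewrite /axis !c3E => /eqP; rewrite oner_eq0.
- by move=> x; exact: (cvgB (c3_continuous 0 x) (c x)).
- by move=> b x b0; rewrite h // c3Z mulrBr.
- by move=> x b; rewrite a /axis !c3E; ring.
have -> : [set x | c3 x 0 - Q x = 0] = [set x | c3 x 0 = Q x].
  by apply/seteqP; split=> x /= => [/eqP|->]; rewrite ?subrr // subr_eq0 => /eqP.
split; first exact: (cone_jordan_curve t).
by move=> x xs; split; [exact: sS|rewrite /= Qs].
Qed.

End Curve.

(** * Uniform estimates for periodic curves *)

Section PeriodicCurve.
Context {R : realType} {V : normedModType R}.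
Variables (h : R -> V) (T : R).
Hypotheses (T0 : 0 < T) (ch : continuous h) (ph : periodic h T).

Lemma periodicz (k : int) a : h (a + T *~ k) = h a.
Proof.
case: k => n; first exact: periodicn.
rewrite NegzE mulrNz -[in RHS](subrK (T *~ n.+1) a).
by rewrite -[in RHS]pmulrn (periodicn ph).
Qed.

Lemma period_reduction (x : R) : exists k : int, 0 <= x - T *~ k <= T.
Proof.
exists (Num.floor (x / T)).
have h1 := ge_floor (x / T); have h2 := floorD1_gt (x / T).
move: h1 h2; rewrite ler_pdivlMr // ltr_pdivrMr // intrD mulrDl mul1r.
rewrite -mulrzl; lra.
Qed.

Lemma periodic_uniform (e : R) : 0 < e -> exists2 d : R, 0 < d &
  forall a b, `|a - b| < d -> `|h a - h b| < e.
Proof.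
(* The period is widened by 1 on both sides, so that [b] stays in the interval when [a] is reduced
   to one period. *)
move=> e0; have ch' : cts_on (`[- 1, T + 1]%classic : set R) h.
  by apply: cts_onW => x _; exact: ch.
have [d d0 Hd] := cts_on_uniform _ h e (@segment_compact R (-1) (T + 1)) ch' e0.
exists (Num.min d 1); first by rewrite lt_min d0 ltr01.
move=> a b; rewrite lt_min => /andP[abd ab1].
have [k k01] := period_reduction a.
rewrite -[a](subrK (T *~ k)) -[b](subrK (T *~ k)) !periodicz.
move: ab1; rewrite ltr_norml => ab1.
apply: Hd; rewrite /= ?in_itv /=; try lra.
by rewrite opprB addrA subrK.
Qed.

(** Over one period, values at parameters away from the fibre of [y] keep a distance from [y], so a
    value close to [y] forces a parameter of the fibre nearby. The bound 1 on the parameter distance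
    becomes [d^-j] after pulling back. *)
Lemma periodic_near_value (y : V) (rho : R) : 0 < rho ->
  exists2 lam : R, 0 < lam & forall th, `|h th - y| < lam ->
    exists a, [/\ `|a - th| <= 1, h a = y &
      forall u : R, 0 <= u <= 1 -> `|h (a + u * (th - a)) - y| < rho].
Proof.
move=> rho0; have [|x xT|lam lam0 H] := @compact_uniform R R `[0, T] (fun d th =>
    `|h th - y| < d -> exists a, [/\ `|a - th| <= 1, h a = y &
      forall u : R, 0 <= u <= 1 -> `|h (a + u * (th - a)) - y| < rho])
    (@segment_compact R 0 T).
- by move=> d d' x dd' H hd; apply: H; exact: lt_le_trans dd'.
- have cx : cts_on (setT : set R) h by apply: cts_onW => z _; exact: ch.
  have [hx|hx] := pselect (h x = y).
    have [d d0 Hd] := cx x I rho rho0.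
    exists (Num.min d 1); first by rewrite lt_min d0 ltr01.
    move=> z _; rewrite lt_min => /andP[zd z1] _; exists x; split => //.
      by rewrite distrC ltW.
    move=> u /andP[u0 u1]; rewrite -hx; apply: Hd => //.
    rewrite addrAC subrr add0r normrM ger0_norm //.
    by have := normr_ge0 (z - x); nra.
  have hx0 : 0 < `|h x - y| by rewrite normr_gt0 subr_eq0; apply/eqP.
  have [|d d0 Hd] := cx x I (`|h x - y| / 2); first by lra.
  exists (Num.min d (`|h x - y| / 2)); first by rewrite lt_min d0; lra.
  move=> z _; rewrite !lt_min => /andP[zd _] /andP[_ hz].
  have := Hd z I zd; have := ler_distD (h z) (h x) y.
  by rewrite [`|h x - h z|]distrC; lra.
- exists lam => // th hth; have [k k01] := period_reduction th.
  have [||a [a1 ha Ha]] := H (th - T *~ k); first by rewrite /= in_itv.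
    by rewrite -(periodicz k) subrK.
  exists (a + T *~ k); split; last 1 first.
  + move=> u u01; rewrite -(periodicz (- k)) mulrNz.
    have -> : a + T *~ k + u * (th - (a + T *~ k)) - T *~ k =
      a + u * (th - T *~ k - a) by ring.
    exact: Ha.
  + by rewrite (_ : a + _ - th = a - (th - T *~ k)) //; ring.
  + by rewrite periodicz.
Qed.

End PeriodicCurve.

(** * From the semiconjugacy to expansion *)

Section Expansion.
Context {R : realType}.
Local Notation P2 := 'rV[R]_2.
Local Notation P3 := 'rV[R]_3.
Local Notation unitI := (`[0, 1]%classic : set R).

(** As [post f] is not empty, there is a critical point; two points identified by [f] near it lie in
    one fibre of the iterate, which has at most [d] points. *)
Lemma branched_degree_gt1 (f : P3 -> P3) n d : thurston_map f -> (0 < n)%N ->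
  is_degree (iter n f) d -> (1 < d)%N.
Proof.
move=> [[Sf _ _] _ [a [_ [_ [[[c [_ [[Sc [q [q1 lq]]] _]]] _] _ _ _]]]]] n0 [dF _].
rewrite ltnNge; apply/negP => d1.
have [z [z' [Sz Sz' zz' fz]]] := local_form_noninj f c q q1 lq.
apply: zz'; have /pcard_leP[h] : ([set x | S2 R x /\ iter n f x = iter n f z] #<= `I_1)%card.
  apply: card_le_trans (dF _ (S2_iter f n z Sf Sz)) _.
  by rewrite card_le_II.
have Fz : iter n f z' = iter n f z by rewrite -(prednK n0) !iterSr fz.
have h0 x : S2 R x /\ iter n f x = iter n f z -> h x = 0%N.
  by move=> /(@funS _ _ _ _ h); rewrite /= ltnS leqn0 => /eqP.
have hz : h z = h z' by rewrite !h0.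
by apply: (@inj _ _ _ h z z'); rewrite ?inE.
Qed.

Lemma min_radius (n : nat) (P : nat -> R -> Prop) :
  (forall r l l', l' <= l -> P r l -> P r l') ->
  (forall r, exists2 l : R, 0 < l & P r l) ->
  exists2 l : R, 0 < l & forall r, (r < n)%N -> P r l.
Proof.
move=> mP eP; elim: n => [|n [l l0 Hl]]; first by exists 1.
have [l' l'0 Hl'] := eP n; exists (Num.min l l'); first by rewrite lt_min l0.
move=> r; rewrite ltnS leq_eqVlt => /orP[/eqP ->|rn].
  by apply: mP Hl'; rewrite ge_min lexx orbT.
by apply: mP (Hl r rn); rewrite ge_min lexx.
Qed.

Section PeanoCurve.
Variables (f : P3 -> P3) (n d : nat) (gamma : P2 -> P3).
Hypotheses (bf : branched_cover f) (fin : finite_set (post f)).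
Hypotheses (n0 : (0 < n)%N) (d1 : (1 < d)%N).
Hypotheses (cg : {within (S1 R), continuous gamma}).
Hypotheses (sg : gamma @` (S1 R) = S2 R).
Hypotheses (fg : forall z, S1 R z -> iter n f (gamma z) = gamma (cpow z d)).

Let Gam (th : R) : P3 := gamma (cis th).

Let Gam_S2 th : S2 R (Gam th).
Proof. by rewrite -sg; exists (cis th) => //; exact: cis_S1. Qed.

Let Gam_cts : cts_on setT Gam.
Proof.
apply: (@cts_on_comp _ R P2 P3 setT (S1 R) cis gamma).
- by move=> th _; exact: cis_S1.
- by apply: cts_onW => x _; exact: cis_continuous.
- exact/cts_onP.
Qed.

Let Gam_surj x : S2 R x -> exists th, x = Gam th.
Proof. by rewrite -sg => -[z /S1_polar[th ->] <-]; exists th. Qed.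

Let Gam_iter j th : iter (j * n) f (Gam th) = Gam (d%:R ^+ j * th).
Proof.
rewrite iterM; elim: j => [|j IH]; first by rewrite expr0 mul1r.
by rewrite iterS IH /Gam fg ?cpow_cis ?exprS ?mulrA //; exact: cis_S1.
Qed.

Let iterf_Gam_continuous r : continuous (iter r f \o Gam).
Proof.
have : cts_on setT (iter r f \o Gam).
  apply: (@cts_on_comp _ R P3 P3 setT (S2 R)) => //.
  exact: (bm_cts _ _ _ (branched_map_iter f r bf)).
move=> c x; apply/cvgrPdist_lt => e e0; have [l l0 H] := c x I e e0.
apply/nbhs_ballP; exists l => //= z zx.
by rewrite distrC; apply: H => //; rewrite distrC.
Qed.

Let Gam_periodic r : periodic (iter r f \o Gam) (pi *+ 2).
Proof. by move=> u; rewrite /= /Gam /cis cosD2pi sinD2pi. Qed.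

Let pi2_gt0 : 0 < pi *+ 2 :> R.
Proof. by rewrite mulrn_wgt0 // pi_gt0. Qed.

(* A preimage of a point near [y] is joined to a preimage of [y] by the image
   under [gamma] of an arc of length at most [d^-j]; by [unique_centre_rad]
   connectedness of [K] makes these preimages of [y] coincide. *)
Lemma small_preimages_at (y : P3) : S2 R y -> exists2 lam : R, 0 < lam &
  forall e : R, 0 < e -> exists N, forall m, (N <= m)%N ->
    forall K, connected K -> K `<=` S2 R ->
      (forall k, K k -> `|iter m f k - y| < lam) ->
      forall k k', K k -> K k' -> `|k - k'| <= e.
Proof.
move=> Sy; have [c /andP[c0 c1] Pc] := cap_isolating (post f) y fin (post_S2 f bf) Sy.
have [rho rho0 Hrho] := cap_nbhs y c Sy c1.
(* Writing [m = r + j n] with [r < n], only the [n] curves [iter r f \o Gam] occur near [y], so one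
   radius serves all [m]. *)
have [||lam lam0 Hlam] := min_radius n (fun r l =>
  l <= rho /\ forall th, `|iter r f (Gam th) - y| < l ->
    exists a, [/\ `|a - th| <= 1, iter r f (Gam a) = y &
      forall u : R, 0 <= u <= 1 -> `|iter r f (Gam (a + u * (th - a))) - y| < rho]).
- move=> r l l' l'l [lr H]; split; first exact: le_trans lr.
  by move=> th thl; apply: H; exact: lt_le_trans l'l.
- move=> r; have [l l0 Hl] := periodic_near_value _ _ pi2_gt0
    (iterf_Gam_continuous r) (Gam_periodic r) y rho rho0.
  exists (Num.min l rho); first by rewrite lt_min l0.
  split; first by rewrite ge_min lexx orbT.
  by move=> th; rewrite lt_min => /andP[thl _]; exact: Hl.
exists lam => // e e0.
have [|del del0 Hdel] := periodic_uniform _ _ pi2_gt0 (iterf_Gam_continuous 0)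
  (Gam_periodic 0) (e / 2); first by lra.
have [J [J0 HJ]] : exists J, (0 < J)%N /\ J%:R^-1 < del.
  by have [J J0 HJ] := mesh_exists del del0; exists J.
exists (J * n)%N => m Nm.
pose j := (m %/ n)%N; pose r := (m %% n)%N.
have rn : (r < n)%N by rewrite ltn_mod.
have mE : m = (r + j * n)%N by rewrite addnC -divn_eq.
have Jj : (J <= j)%N by rewrite leq_divRL.
have dj0 : (0 : R) < d%:R ^+ j by rewrite exprn_gt0 // ltr0n ltnW.
have djl : (d%:R ^+ j)^-1 < del.
  apply: le_lt_trans HJ; rewrite lef_pV2 ?posrE ?ltr0n //.
  rewrite -natrX ler_nat (leq_trans Jj) // ltnW //.
  exact: ltn_expl.
have fm th : iter m f (Gam th) = iter r f (Gam (d%:R ^+ j * th)).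
  by rewrite mE iterD Gam_iter.
have [lr Hr] := Hlam r rn.
have join k : S2 R k -> `|iter m f k - y| < lam -> exists x Q,
    [/\ connected Q, Q `<=` S2 R, Q k /\ Q x,
        forall q, Q q -> cap y c (iter m f q) &
        iter m f x = y /\ `|k - x| < e / 2].
  move=> /Gam_surj[th ->]; rewrite fm => /Hr[a [a1 fa Ha]].
  (* The arc from [a] to [d^j th], divided by [d^j]: it runs from a preimage of [y] at [u = 0] to
     [th] at [u = 1]. *)
  pose s (u : R) : R := (a + u * (d%:R ^+ j * th - a)) / d%:R ^+ j.
  have s1 : s 1 = th by rewrite /s mul1r addrC subrK mulrC mulKf // lt0r_neq0.
  have sE u : d%:R ^+ j * s u = a + u * (d%:R ^+ j * th - a).
    by rewrite /s mulrC divfK // lt0r_neq0.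
  exists (Gam (s 0)), ((Gam \o s) @` unitI); split.
  - apply: cts_on_connected; first exact: segment_connected.
    apply: (@cts_on_comp _ R R P3 unitI setT s Gam) => //.
    apply: cts_onW => u _.
    exact: (cvgM (cvgD (cvg_cst a) (cvgM cvg_id (cvg_cst _))) (cvg_cst _)).
  - by move=> _ [u _ <-]; exact: Gam_S2.
  - split; last by exists 0 => //; rewrite /= in_itv /= lexx ler01.
    by exists 1; rewrite /= ?s1 // in_itv /= lexx ler01.
  - move=> _ [u /= + <-]; rewrite in_itv /= => u01; apply: Hrho.
      by apply: S2_iter => //; case: bf.
    by rewrite fm sE; exact: Ha.
  - split; first by rewrite fm sE mul0r addr0.
    apply: (Hdel th (s 0)); rewrite /s mul0r addr0.
    apply: le_lt_trans djl.
    rewrite -{1}s1 /s mul1r [a + _]addrC subrK -mulrBl normrM normfV.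
    rewrite [`|d%:R ^+ j|]gtr0_norm // distrC.
    by rewrite ler_pdivrMr // mulVf ?lt0r_neq0.
move=> K cK KS Kl k k' Kk Kk'.
have [x [Q [cQ QS [Qk Qx] Qc [fx kx]]]] := join k (KS k Kk) (Kl k Kk).
have [x' [Q' [cQ' Q'S [Q'k Q'x] Q'c [fx' kx']]]] := join k' (KS k' Kk') (Kl k' Kk').
(* [K] together with the two arcs is connected, and [iter m f] maps it into the cap, where [post f]
   has no point other than [y]. *)
have xx' : x = x'.
  have bm := branched_map_iter f m bf.
  have y0 := S2_neq0 y Sy.
  have ny : nrm y = y := nrm_id y Sy.
  apply: (unique_centre_rad (post f) (iter m f) (cap y c) y bm _ _ y0 _ _ (Q `|` K `|` Q')).
  - exact: cap_compact.
  - by move=> ? [].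
  - by move=> z t cz t01; case: (cap_rad y c z t Sy c0 cz t01).
  - rewrite ny => z t cz zy /andP[t0 t1] Pz; apply: zy.
    apply: (rad_eq_centre y c z t) => //; first by rewrite t0.
    apply: Pc; split => //.
    by case: (cap_rad y c z t Sy c0 cz) => //; rewrite t0 ltW.
  - apply: connectedU => //; first by exists k'; split => //; right.
    by apply: connectedU => //; exists k.
  - by move=> z [[]|]; [exact: QS|exact: KS|exact: Q'S].
  - move=> z [[|Kz]|]; [exact: Qc| |exact: Q'c].
    apply: Hrho; last by apply: lt_le_trans lr; exact: Kl.
    by apply: S2_iter; [case: bf|exact: KS].
  - by left; left.
  - by right.
  - by rewrite ny.
  - by rewrite ny.
have := ler_distD x k k'; rewrite xx' [`|x' - k'|]distrC; rewrite xx' in kx; lra.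
Qed.

(** Compactness is used twice, since [lam] is fixed before [e]: once for [lam], then for [N] with
    [e] given. Each time half of [lam] pays for moving the centre [y]. *)
Lemma small_preimages : exists2 lam : R, 0 < lam &
  forall e : R, 0 < e -> exists N, forall y, S2 R y -> forall m, (N <= m)%N ->
    forall K, connected K -> K `<=` S2 R ->
      (forall k, K k -> `|iter m f k - y| < lam) ->
      forall k k', K k -> K k' -> `|k - k'| <= e.
Proof.
have [|y Sy|lam lam0 H] := @compact_uniform R P3 (S2 R) (fun lam y =>
  forall e : R, 0 < e -> exists N, forall m, (N <= m)%N ->
    forall K, connected K -> K `<=` S2 R ->
      (forall k, K k -> `|iter m f k - y| < lam) ->
      forall k k', K k -> K k' -> `|k - k'| <= e) S2_compact.
- move=> l l' y l'l H e e0; have [N HN] := H e e0; exists N => m Nm K cK KS Kl.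
  by apply: (HN m Nm) => // k Kk; apply: lt_le_trans l'l; exact: Kl.
- have [lam lam0 Hl] := small_preimages_at y Sy.
  exists (lam / 2); first by lra.
  move=> z Sz zy e e0; have [N HN] := Hl e e0; exists N => m Nm K cK KS Kl.
  apply: (HN m Nm) => // k Kk; have := Kl k Kk.
  by have := ler_distD z (iter m f k) y; lra.
exists (lam / 2); first by lra.
move=> e e0.
have [|y Sy|N HN] := @compact_uniform_nat R P3 (S2 R) (fun N y =>
  forall m, (N <= m)%N -> forall K, connected K -> K `<=` S2 R ->
      (forall k, K k -> `|iter m f k - y| < lam / 2) ->
      forall k k', K k -> K k' -> `|k - k'| <= e) S2_compact.
- by move=> N M y NM HN m Mm; apply: HN; exact: leq_trans Mm.
- have [N HN] := H y Sy e e0; exists N, (lam / 2); first by lra.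
  move=> z Sz zy m Nm K cK KS Kl; apply: (HN m Nm) => // k Kk.
  by have := Kl k Kk; have := ler_distD z (iter m f k) y; lra.
by exists N.
Qed.

(** * Components on one side of the curve *)

Section Side.
Variables (v : P3) (G : P3 -> R).
Hypotheses (v0 : v <> 0) (cG : continuous G).
Hypotheses (hG : forall a x, 0 <= a -> G (a *: x) = a * G x).
Hypotheses (aG : forall x s, G (x + s *: v) = G x + s).
Hypotheses (PG : forall p, post f p -> G p = 0).

Let G_seg x t : 0 <= t <= 1 -> G ((1 - t) *: x + t *: v) = (1 - t) * G x + t.
Proof. by move=> /andP[t0 t1]; rewrite aG hG // subr_ge0. Qed.

Let seg_neq0 x (t : R) : S2 R x -> 0 <= G x -> 0 <= t <= 1 ->
  (1 - t) *: x + t *: v <> 0.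
Proof.
move=> Sx Gx t01 e; have := G_seg x t t01; rewrite e.
have -> : G 0 = 0 by rewrite -(scale0r 0) hG // mul0r.
case/andP: (t01) => t0 t1 h.
have tz : t = 0 by nra.
by move: e; rewrite tz subr0 scale1r scale0r addr0; exact: S2_neq0.
Qed.

Let G_rad x (t : R) : S2 R x -> 0 < G x -> 0 <= t <= 1 -> 0 < G (rad v x t).
Proof.
move=> Sx Gx t01; have [a a0] := nrm_scale _ (seg_neq0 x t Sx (ltW Gx) t01).
rewrite -/(rad v x t) => ->; rewrite hG ?ltW // mulr_gt0 // G_seg //.
by case/andP: t01 => t0 t1; nra.
Qed.

Let G_iter_cts m : cts_on (S2 R) (G \o iter m f).
Proof.
apply: (@cts_on_comp _ P3 P3 R (S2 R) setT) => //.
  exact: (bm_cts _ _ _ (branched_map_iter f m bf)).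
by apply: cts_onW => x _; exact: cG.
Qed.

Let level_compact (c : R) : compact (S2 R `&` [set x | c <= G x]).
Proof.
apply: (subclosed_compact _ S2_compact); last by move=> ? [].
apply: closedI; first by apply: compact_closed; [exact: norm_hausdorff|exact: S2_compact].
apply: (@closed_comp _ _ G [set t | c <= t]); last exact: closed_ge.
by move=> x _; exact: cG.
Qed.

(** [unique_centre_rad] needs a compact set off [post f], but [G] may tend to 0 on the image of [W].
    So [W] is replaced by a connected set [Q] joining [x] to [x'] on which [G] is at least some
    [eta > 0]; being joined to [x] in this way is locally constant on [W], as small connected sets
    can be attached. *)
Lemma side_unique_centre m W x x' : connected W -> W `<=` S2 R ->
  (forall w, W w -> 0 < G (iter m f w)) -> W x -> W x' ->
  iter m f x = nrm v -> iter m f x' = nrm v -> x = x'.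
Proof.
move=> cW WS WG Wx Wx' fx fx'.
pose phi k := exists Q (eta : R), [/\ connected Q, Q `<=` S2 R, 0 < eta,
  (forall q, Q q -> eta <= G (iter m f q)) & Q x /\ Q k].
suff : phi x'.
  move=> [Q [eta [cQ QS eta0 QG [Qx Qx']]]].
  apply: (unique_centre_rad (post f) (iter m f) (S2 R `&` [set x | eta <= G x]) v
    (branched_map_iter f m bf) (level_compact eta) _ v0 _ _ Q) => //.
  - by move=> z t [Sz /= Gz] t01; apply: seg_neq0 => //; lra.
  - move=> z t [Sz /= Gz] _ /andP[t0 t1] /PG.
    by apply/eqP/lt0r_neq0/G_rad; rewrite ?t0 ?ltW //; lra.
  - move=> q Qq; split; last exact: QG.
    by apply: S2_iter; [case: bf|exact: QS].
have : phi x.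
  exists [set x], (G (iter m f x)); split => //.
  - exact: connected1.
  - by move=> _ ->; exact: WS.
  - exact: WG.
  - by move=> _ ->.
move: x x' Wx Wx' {fx fx'} @phi => x x' Wx Wx' phi.
apply: (connected_locally_constant W) => // k Wk.
pose eta0 := G (iter m f k) / 2.
have eta00 : 0 < eta0 by rewrite /eta0 divr_gt0 //; exact: WG.
have [r r0 Hr] := G_iter_cts m k (WS k Wk) eta0 eta00.
have [l l0 Hl] := S2_locally_connected k r (WS k Wk) r0.
exists l => // k' Wk' k'k.
have [Q0 [cQ0 Q0S Q0k Q0k' Q0r]] := Hl k' (WS k' Wk') k'k.
have Q0G q : Q0 q -> eta0 <= G (iter m f q).
  move=> Qq; have := Hr q (Q0S q Qq) (Q0r q Qq).
  by rewrite /= ltr_norml /eta0; lra.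
have ext a b : Q0 a -> Q0 b -> phi a -> phi b.
  move=> Q0a Q0b [Q [eta [cQ QS eta_gt0 QG [Qx Qa]]]].
  exists (Q `|` Q0), (Num.min eta eta0); split.
  - by apply: connectedU => //; exists a.
  - by move=> q []; [exact: QS|exact: Q0S].
  - by rewrite lt_min eta_gt0.
  - by move=> q [/QG|/Q0G] h; rewrite ge_min h ?orbT.
  - by split; [left|right].
by split; apply: ext.
Qed.

(** The track from [iter m f k] to [nrm v] is cut into [M] pieces that move less than [lam], so each
    lifted piece has diameter at most [e / (2 M)]. Every [k] is then within [e / 2] of a point over
    [nrm v], the same one for the whole of [W]. *)
Lemma side_diameter (e : R) : 0 < e -> exists N, forall m, (N <= m)%N ->
  forall W, connected W -> W `<=` S2 R ->
    (forall w, W w -> 0 < G (iter m f w)) ->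
    forall k k', W k -> W k' -> `|k - k'| <= e.
Proof.
move=> e0; have [lam lam0 Hlam] := small_preimages.
(* The closed side, curve included: its compactness gives one modulus of continuity for all tracks,
   so [M] does not depend on [m]. *)
pose D := S2 R `&` [set x | 0 <= G x].
have cD : compact D by exact: level_compact.
have cR : cts_on (D `*` unitI) (fun ut : P3 * R => rad v ut.1 ut.2).
  by apply: rad_cts => x t [Sx Gx]; exact: seg_neq0.
have cDI : compact (D `*` unitI) by apply: compact_setX => //; exact: segment_compact.
have [et et0 Het] := cts_on_uniform _ _ lam cDI cR lam0.
have [M M0 Me] := mesh_exists et et0.
have M0' : (0 : R) < M%:R by rewrite ltr0n.
pose e' := e / (2 * M%:R).
have e'0 : 0 < e' by rewrite divr_gt0 // mulr_gt0.
have Me' : M%:R * e' = e / 2 by rewrite /e'; field; rewrite lt0r_neq0.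
have [N HN] := Hlam e' e'0; exists N => m Nm W cW WS WG.
have bm := branched_map_iter f m bf.
have join k : S2 R k -> 0 < G (iter m f k) -> exists x Q,
    [/\ connected Q, Q `<=` S2 R, Q k /\ Q x,
        forall q, Q q -> 0 < G (iter m f q) &
        iter m f x = nrm v /\ `|k - x| <= e / 2].
  move=> Sk Gk; have Sfk : S2 R (iter m f k) := bm_map _ _ _ bm k Sk.
  have Dfk : D (iter m f k) by split => //=; exact: ltW.
  have [||||q [cq q0 qP]] := path_lift S2_compact bm (rad v (iter m f k)) k.
  - by apply: rad_cts1 => t t01; apply: seg_neq0 => //; exact: ltW.
  - move=> t t01; split.
      by apply: nrm_S2; apply: seg_neq0 => //; exact: ltW.
    by move=> /PG; apply/eqP/lt0r_neq0; exact: G_rad.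
  - by [].
  - by rewrite rad0.
  have I0 : unitI 0 by rewrite /= in_itv /= lexx ler01.
  have I1 : unitI 1 by rewrite /= in_itv /= lexx ler01.
  exists (q 1), (q @` unitI); split.
  - by apply: cts_on_connected => //; exact: segment_connected.
  - by move=> _ [t /= + <-]; rewrite in_itv /= => /qP[].
  - by split; [exists 0|exists 1].
  - move=> _ [t /= + <-]; rewrite in_itv /= => t01; have [_ ->] := qP t t01.
    exact: G_rad.
  - have [|_ ->] := qP 1; first by rewrite lexx ler01.
    rewrite rad1; split => //.
    have step i : (i <= M)%N -> `|q 0 - q (i%:R / M%:R)| <= i%:R * e'.
      elim: i => [|i IH] iM; first by rewrite mul0r subrr normr0 mul0r.
      have {}IH := IH (ltnW iM).
      have ii1 : (i%:R / M%:R : R) <= i.+1%:R / M%:R.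
        by rewrite ler_pM2r ?invr_gt0 // ler_nat.
      have i0 : 0 <= (i%:R / M%:R : R) by rewrite divr_ge0.
      have i1 : (i.+1%:R / M%:R : R) <= 1 by rewrite ler_pdivrMr // mul1r ler_nat.
      have iM1 : (i.+1%:R / M%:R : R) = i%:R / M%:R + M%:R^-1.
        by rewrite -natr1 mulrDl mul1r.
      have sub (t : R) : i%:R / M%:R <= t <= i.+1%:R / M%:R -> 0 <= t <= 1.
        by move=> /andP[t1 t2]; apply/andP; split; lra.
      have : `|q (i%:R / M%:R) - q (i.+1%:R / M%:R)| <= e'.
        apply: (HN (rad v (iter m f k) (i%:R / M%:R)) _ m Nm
          (q @` (`[i%:R / M%:R, i.+1%:R / M%:R]%classic : set R))).
        - apply: nrm_S2; apply: seg_neq0 => //; first exact: ltW.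
          by apply: sub; rewrite lexx.
        - apply: cts_on_connected; first exact: segment_connected.
          by apply: cts_onS cq => t /=; rewrite !in_itv /=; exact: sub.
        - by move=> _ [t /= + <-]; rewrite in_itv /= => /sub/qP[].
        - move=> _ [t /= + <-]; rewrite in_itv /= => tI.
          have [_ ->] := qP t (sub t tI).
          apply: (Het (iter m f k, t) (iter m f k, i%:R / M%:R)).
          + by split=> //=; rewrite in_itv /=; exact: sub.
          + by split=> //=; rewrite in_itv /=; apply: sub; rewrite lexx.
          rewrite prod_normE /= gt_max subrr normr0 et0 /=.
          case/andP: tI => t1 t2; rewrite ger0_norm; last by lra.
          by apply: le_lt_trans Me; lra.
        - by exists (i%:R / M%:R) => //=; rewrite in_itv /= lexx.
        - by exists (i.+1%:R / M%:R) => //=; rewrite in_itv /= lexx ii1.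
      have := ler_distD (q (i%:R / M%:R)) (q 0) (q (i.+1%:R / M%:R)).
      by rewrite -[in i.+1%:R * e']natr1 mulrDl mul1r; lra.
    have := step M (leqnn M); rewrite mulfV ?lt0r_neq0 // Me'.
    by rewrite {1}q0.
move=> k k' Wk Wk'.
have [x [Q [cQ QS [Qk Qx] QG [fx kx]]]] := join k (WS k Wk) (WG k Wk).
have [x' [Q' [cQ' Q'S [Q'k Q'x] Q'G [fx' kx']]]] := join k' (WS k' Wk') (WG k' Wk').
have xx' : x = x'.
  apply: (side_unique_centre m (Q `|` W `|` Q')) => //.
  - apply: connectedU => //; first by exists k'; split => //; right.
    by apply: connectedU => //; exists k.
  - by move=> z [[]|]; [exact: QS|exact: WS|exact: Q'S].
  - by move=> z [[]|]; [exact: QG|exact: WG|exact: Q'G].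
  - by left; left.
  - by right.
by have := ler_distD x k k'; rewrite xx' [`|x' - k'|]distrC; rewrite xx' in kx; lra.
Qed.

End Side.

Lemma peano_expanding : expanding f.
Proof.
have [v [G [v0 cG hG aG [jC PC]]]] := exists_cone_curve (post f) fin (post_S2 f bf).
exists (S2 R `&` [set x | G x = 0]); split => // e e0.
have PG p : post f p -> G p = 0 by move=> /PC[].
have [N1 H1] := side_diameter v G v0 cG hG aG PG e e0.
(* The side where [G < 0] is the positive side of [- G] in the direction [- v]. *)
have [||||||N2 H2] := side_diameter (- v) (fun x => - G x) _ _ _ _ _ e.
- by move=> h; apply: v0; rewrite -[v]opprK h oppr0.
- by move=> x; exact: (cvgN (cG x)).
- by move=> a x a0; rewrite hG // mulrN.
- by move=> x s; rewrite scalerN -scaleNr aG opprD opprK.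
- by move=> p /PG ->; rewrite oppr0.
- exact: e0.
exists (maxn N1 N2) => m; rewrite geq_max => /andP[N1m N2m] x y z W Wx Wy Wz.
have cA : connected (connected_component W x) by exact: component_connected.
have AW : connected_component W x `<=` W by exact: connected_component_sub.
have AS : connected_component W x `<=` S2 R by move=> w /AW[].
have Sm w : S2 R w -> S2 R (iter m f w) by apply: S2_iter; case: bf.
have G0 w : connected_component W x w -> G (iter m f w) <> 0.
  by move=> /AW[Sw /= nC] Gw; apply: nC; split => //; exact: Sm.
have xx : connected_component W x x by apply: connected_component_refl.
have sgn w w' : connected_component W x w -> connected_component W x w' ->
    0 < G (iter m f w) -> 0 < G (iter m f w').
  apply: (connected_locally_constant _ (fun w => 0 < G (iter m f w))) => // k Ak.
  have cGm : cts_on (S2 R) (G \o iter m f).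
    apply: (@cts_on_comp _ P3 P3 R (S2 R) setT) => //.
      exact: (bm_cts _ _ _ (branched_map_iter f m bf)).
    by apply: cts_onW => u _; exact: cG.
  have Gk : 0 < `|G (iter m f k)| by rewrite normr_gt0; apply/eqP; exact: G0.
  have [d' d'0 Hd'] := cGm k (AS k Ak) _ Gk; exists d' => // k' Ak' k'k.
  have := Hd' k' (AS k' Ak') k'k; rewrite /= ltr_norml => /andP[h1 h2].
  have [Gp|Gn|Gz] := ltgtP 0 (G (iter m f k)).
  - by move: h1 h2; rewrite gtr0_norm // => h1 h2; split => _ //; lra.
  - move: h1 h2; rewrite ltr0_norm // ltrBlDr addNr => _ h2; split => // h.
    by have := lt_trans h h2; rewrite ltxx.
  - by case: (G0 k Ak).
have [Gp|Gn|Gz] := ltgtP 0 (G (iter m f x)).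
- by apply: (H1 m N1m (connected_component W x)) => // w Aw; exact: (sgn x).
- apply: (H2 m N2m (connected_component W x)) => // w Aw; rewrite oppr_gt0.
  have [//|Gw|Gw] := ltgtP (G (iter m f w)) 0; last by case: (G0 w Aw).
  by have := sgn w x Aw xx Gw; lra.
- by case: (G0 x xx).
Qed.

End PeanoCurve.

End Expansion.

Theorem theorem1p2 (R : realType) (f : 'rV[R]_3 -> 'rV[R]_3) :
  thurston_map f ->
  (exists (n d : nat) (gamma : 'rV[R]_2 -> 'rV[R]_3),
      [/\ (0 < n)%N, is_degree (iter n f) d,
          {within (S1 R), continuous gamma}, gamma @` (S1 R) = S2 R &
          forall z, S1 R z -> iter n f (gamma z) = gamma (cpow z d)]) ->
  expanding f.
Proof.
move=> tf [n [d [gamma [n0 dF cg sg fg]]]].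
have d1 := branched_degree_gt1 f n d tf n0 dF.
by case: tf => bf fin _; exact: (peano_expanding f n d gamma).
Qed.
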